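(* Let $X$ be a proper NPC space, and let $G$ be a totally disconnected, locally compact group acting properly and locally discretely by isometries on $X$. Let $g \in G$ be hyperbolic, let $Y$ be a nonempty closed convex $\langle g\rangle$-invariant subspace of $X$ and let $K = \mathrm{Fix}_G(Y)$. Let $V$ be minimizing for $g$, let $W = V \cap \mathrm{con}_G(g/K)$ and let $Z = X^W \cap Y$. Suppose $\mathrm{con}_G(g/K)$ is closed in $G$. If $s_G(g^{-1})=1$ then $\mathrm{con}_G(g/K)=K$, so $Z = Y$. Otherwise, $Z$ is a closed convex subspace such that \[ Z \subseteq gZ; \quad \bigcup_{n \ge 0} g^nZ = Y; \quad \bigcap_{n \le 0} g^nZ = \emptyset. \]
   Context: An NPC space is a geodesic metric space $X$ that is either (1) complete and CAT(0), or (2) proper (closed balls are compact) and $\delta$-hyperbolic for some $\delta \ge 0$ (every geodesic triangle is $\delta$-thin: each point on a side lies within distance $\delta$ of a point on another side); here $X$ is moreover assumed proper in both cases. An isometry $g$ is hyperbolic if: in case (1), it has an axis, i.e. there are a geodesic line $\gamma:\mathbb{R}\to X$ and $k>0$ with $g\gamma(t)=\gamma(t+k)$ for all $t$; in case (2), $n\mapsto g^nx$ is a quasi-isometric embedding of $\mathbb{Z}$ into $X$ for some (equivalently any) $x$. An isometric action of $G$ on $X$ is proper if for all $x\in X$, $r>0$ the set $\{g\in G: d(gx,x)\le r\}$ has compact closure; it is locally discrete if around each point of $X$ there is a ball of positive radius whose fixator (pointwise stabilizer) in $G$ is open. $\mathrm{Fix}_G(Y)$ is the pointwise stabilizer of $Y$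 in $G$, and $X^W$ is the set of points of $X$ fixed by every element of $W$. For a closed $\langle g\rangle$-invariant subgroup $K\le G$, $\mathrm{con}_G(g/K)=\{h\in G: g^nhg^{-n}K\to K\text{ in }G/K\text{ as }n\to+\infty\}$. The scale $s_G(g)$ is the minimum of $|gUg^{-1}:U\cap gUg^{-1}|$ over all compact open subgroups $U$ of $G$; a compact open subgroup attaining this minimum is called minimizing for $g$.
   Formalization: If X is hyperbolic but not CAT(0), ''convex'' (for Y and Z) means only: points lying on all geodesics between two points of the set belong to it. With ordinary convexity, ''Z is convex'' can fail there, since W may permute geodesics between two fixed points. *)

(* Defs.v *)
From HB Require Import structures.
From mathcomp Require Import all_boot all_order all_algebra.
From mathcomp Require Import all_classical all_reals all_analysis.

Set Implicit Arguments.
Unset Strict Implicit.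
Unset Printing Implicit Defensive.

Import Order.TTheory GRing.Theory Num.Theory.

Local Open Scope classical_set_scope.
Local Open Scope ring_scope.
Local Open Scope quotient_scope.

HB.mixin Record Group_isTopological G of Group G & Topological G := {
  mulg_continuous : continuous (fun xy : G * G => (xy.1 * xy.2)%g) ;
  invg_continuous : continuous (fun x : G => (x^-1)%g)
}.

#[short(type="topologicalGroupType")]
HB.structure Definition TopologicalGroup :=
  {G of Group G & Topological G & Group_isTopological G}.

(* The Hausdorff property follows from total disconnectedness. *)
Definition tdlc (G : topologicalGroupType) : Prop :=
  totally_disconnected [set: G] /\ locally_compact [set: G].

Definition expgz (G : groupType) (x : G) (m : int) : G :=
  match m with
  | Posz n => (x ^+ n)%g
  | Negz n => (x ^- n.+1)%g
  end.

(* The set x H x^-1; MathComp's [H :^ x] is x^-1 H x, and only for finite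
   groups. *)
Definition conjset (G : groupType) (x : G) (H : set G) : set G :=
  [set (x * h * x^-1)%g | h in H].

Definition leftcoset (G : groupType) (x : G) (H : set G) : set G :=
  [set (x * h)%g | h in H].

Definition subgroup (G : groupType) (H : set G) : Prop :=
  [/\ H 1%g, forall x y, H x -> H y -> H (x * y)%g & forall x, H x -> H (x^-1)%g].

(* |A : B|, with the value 0 when the number of cosets is infinite. *)
Definition index (G : groupType) (A B : set G) : nat :=
  xget 0%N [set n | ([set leftcoset x B | x in A] #= `I_n)%card].

Definition compact_open_subgroup (G : topologicalGroupType) (U : set G) : Prop :=
  [/\ subgroup U, compact U & open U].

Definition displacement_index (G : topologicalGroupType) (g : G) (U : set G) : nat :=
  index (conjset g U) (U `&` conjset g U).

(* The default value 0 is taken only if there is no compact open subgroup,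
   which does not happen in a tdlc group. *)
Definition scale (G : topologicalGroupType) (g : G) : nat :=
  xget 0%N [set n |
    (exists2 U, compact_open_subgroup U & displacement_index g U = n) /\
    (forall U, compact_open_subgroup U -> (n <= displacement_index g U)%N)].

Definition minimizing (G : topologicalGroupType) (g : G) (V : set G) : Prop :=
  compact_open_subgroup V /\ displacement_index g V = scale g.

(* x K = y K is an equivalence relation in x and y for every set K, so that
   the quotient G / K can be formed without a proof that K is a subgroup. *)
Section CosetSpace.
Variables (G : topologicalGroupType) (K : set G).

Definition same_coset : rel G := fun x y => `[< leftcoset x K = leftcoset y K >].

Lemma same_coset_equiv : equiv_class_of same_coset.
Proof.
split.
- by move=> x; apply/asboolP.
- by move=> x y; apply/asboolP/asboolP.
- by move=> y x z /asboolP xy /asboolP yz; apply/asboolP; rewrite xy.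
Qed.

Definition coset_rel : equiv_rel G := EquivRelPack same_coset_equiv.

Definition coset_space : topologicalType :=
  quotient_topology {eq_quot coset_rel}.

Definition to_coset (x : G) : coset_space := \pi_({eq_quot coset_rel}) x.

End CosetSpace.

Definition con (G : topologicalGroupType) (g : G) (K : set G) : set G :=
  [set h | (fun n : nat => to_coset K (g ^+ n * h * g ^- n)%g) @ \oo
           --> to_coset K 1%g].

Section MetricGeometry.
Variables (R : realType) (X : metricType R).

Definition geodesic_segment (x y : X) (S : set X) : Prop :=
  exists c : R -> X,
    [/\ c 0 = x,
        c (mdist x y) = y,
        {in `[0, mdist x y] &, forall s t, mdist (c s) (c t) = `|s - t|}
      & S = c @` [set` `[0, mdist x y]]].

Definition geodesic_space : Prop :=
  forall x y : X, exists S, geodesic_segment x y S.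

Definition geodesic_triangle (p q r : X) (A B C : set X) : Prop :=
  [/\ geodesic_segment p q A, geodesic_segment q r B & geodesic_segment r p C].

Definition proper_space : Prop :=
  forall (x : X) (r : R), compact [set y | mdist x y <= r].

Definition complete_space : Prop :=
  forall F : set_system X, ProperFilter F -> cauchy F -> exists x : X, F --> x.

(* The library's norm on R * R is the sup norm. *)
Definition eucl_dist (u v : R * R) : R :=
  Num.sqrt ((u.1 - v.1) ^+ 2 + (u.2 - v.2) ^+ 2).

(* [u'] is the comparison point of the point [u] of a side from [p] to [q]. *)
Definition comparison_point (p q : X) (p' q' : R * R) (u : X) (u' : R * R) :=
  eucl_dist p' u' = mdist p u /\ eucl_dist u' q' = mdist u q.

(* Since the triangle is arbitrary and its sides are unoriented sets, it
   suffices to compare points on the two sides meeting at [p]. *)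
Definition cat0 : Prop :=
  forall (p q r : X) (A B C : set X), geodesic_triangle p q r A B C ->
  forall p' q' r' : R * R,
    eucl_dist p' q' = mdist p q ->
    eucl_dist q' r' = mdist q r ->
    eucl_dist r' p' = mdist r p ->
  forall (u v : X) (u' v' : R * R), A u -> C v ->
    comparison_point p q p' q' u u' ->
    comparison_point r p r' p' v v' ->
    mdist u v <= eucl_dist u' v'.

(* As above, it suffices to treat one side of an arbitrary triangle. *)
Definition gromov_hyperbolic : Prop :=
  exists2 delta : R, 0 <= delta &
  forall (p q r : X) (A B C : set X), geodesic_triangle p q r A B C ->
  forall u, A u -> exists2 v, (B `|` C) v & mdist u v <= delta.

Definition npc_cat0 : Prop :=
  [/\ geodesic_space, complete_space & cat0].

Definition npc_hyperbolic : Prop :=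
  [/\ geodesic_space, proper_space & gromov_hyperbolic].

Definition npc_space : Prop := npc_cat0 \/ npc_hyperbolic.

(* In the CAT(0) case this is the usual notion, since there the first clause
   implies the second.  In the hyperbolic case, where two points may be joined
   by several geodesic segments, only the points common to all of them are
   required: the fixed-point set of a group of isometries need not contain a
   single geodesic segment between two of its points (the group may permute
   the segments without fixing any), but it contains their intersection. *)
Definition convex_subset (C : set X) : Prop :=
  (npc_cat0 -> forall x y S, C x -> C y -> geodesic_segment x y S -> S `<=` C) /\
  (forall x y p, C x -> C y -> (forall S, geodesic_segment x y S -> S p) -> C p).

End MetricGeometry.

Section Actions.
Variables (R : realType) (X : metricType R) (G : topologicalGroupType).
Variable act : G -> X -> X.

Definition isometric_action : Prop :=
  [/\ forall x, act 1%g x = x,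
      forall g h x, act (g * h)%g x = act g (act h x)
    & forall g x y, mdist (act g x) (act g y) = mdist x y].

Definition proper_action : Prop :=
  forall (x : X) (r : R), 0 < r ->
    compact (closure [set g | mdist (act g x) x <= r]).

Definition fixator (Y : set X) : set G :=
  [set g | forall y, Y y -> act g y = y].

Definition fixed_points (W : set G) : set X :=
  [set x | forall w, W w -> act w x = x].

Definition locally_discrete : Prop :=
  forall x : X, exists2 r : R, 0 < r & open (fixator (ball x r)).

Definition invariant_under_powers (g : G) (Y : set X) : Prop :=
  forall m : int, act (expgz g m) @` Y `<=` Y.

Definition has_axis (g : G) : Prop :=
  exists gamma : R -> X,
    (forall s t, mdist (gamma s) (gamma t) = `|s - t|) /\
    exists2 k : R, 0 < k & forall t, act g (gamma t) = gamma (t + k).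

Definition quasi_isometric_orbit (g : G) : Prop :=
  exists (x : X) (L C : R), [/\ 1 <= L, 0 <= C &
    forall m n : int,
      L^-1 * `|(m - n)%:~R| - C <= mdist (act (expgz g m) x) (act (expgz g n) x)
      /\ mdist (act (expgz g m) x) (act (expgz g n) x)
         <= L * `|(m - n)%:~R| + C].

Definition hyperbolic_element (g : G) : Prop :=
  (npc_cat0 X /\ has_axis g) \/ (npc_hyperbolic X /\ quasi_isometric_orbit g).

End Actions.

(* Main.v *)
(* Write alpha for conjugation by g, L for con_G(g/K) and s for the scale of
   alpha.  Since the action is proper and locally discrete, fixators of large
   balls of Y are compact open subgroups decreasing to K, and L is the set of h
   such that alpha^n(h) eventually lies in each of them.

   The group-theoretic input is that a minimizing subgroup V is tidy, in the
   form: if h is in V and the forward alpha-orbit of h is relatively compact,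
   then alpha(h) is in V.  Minimality gives V = V_+ V_-; one constructs a compact
   open U with |alpha^n U : U ∩ alpha^n U| = |alpha U : U ∩ alpha U|^n; since the
   growth rate of these indices does not depend on U, it is s, hence
   |alpha^n V : V ∩ alpha^n V| = s^n and V ∩ alpha^n V = V ∩ ... ∩ alpha^n V.  The
   claim follows by the pigeonhole principle.

   Applied to W = V ∩ L it gives alpha(W) <= W, that is Z <= gZ.  If L is closed, W
   is compact, so by a Baire argument W contracts uniformly, and each point of Y
   is fixed by alpha^n(W) for n large: this is the statement on the union.  A
   point in the intersection of the g^n Z would be fixed by L.  Let then U be
   minimizing for g^-1.  Shadowing of pseudo-orbits in U_0 gives U_- <= U_0 L, so
   U_- has bounded orbits, alpha^-1(U) <= U and the scale of g^-1 is 1. *)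

Require Import Defs.
From mathcomp Require Import all_boot all_order all_algebra.
From mathcomp Require Import all_classical all_reals all_analysis.
From mathcomp Require Import zify lra.

Local Open Scope classical_set_scope.
Local Open Scope ring_scope.

Ltac gsimp := rewrite ?(invgM, invgK, invg1, mulgA, mulgK, mulgVK, mulgV, mulVg, mulg1, mul1g).

Section Development.
Set Implicit Arguments.
Unset Strict Implicit.
Unset Printing Implicit Defensive.
Import Order.TTheory GRing.Theory Num.Theory.
Local Open Scope group_scope.

(** * Covering and separation by cosets *)

Section Cosets.
Variable G : groupType.
Implicit Types (A B C D : set G) (m n k : nat).

Lemma subgroup1 A : subgroup A -> A 1. Proof. by case. Qed.

Lemma subgroupM A x y : subgroup A -> A x -> A y -> A (x * y).
Proof. by case=> _ + _; apply. Qed.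

Lemma subgroupV A x : subgroup A -> A x -> A x^-1.
Proof. by case=> _ _; apply. Qed.

Lemma subgroupI A B : subgroup A -> subgroup B -> subgroup (A `&` B).
Proof.
move=> [A1 AM AV] [B1 BM BV]; split=> //.
- by move=> x y [? ?] [? ?]; split; [apply: AM|apply: BM].
- by move=> x [? ?]; split; [apply: AV|apply: BV].
Qed.

Lemma subgroup_leftcosetP A x y : subgroup A ->
  leftcoset x A = leftcoset y A <-> A (x^-1 * y).
Proof.
move=> [A1 AM AV]; split=> [xy|xy].
  have : leftcoset y A y by exists 1; rewrite ?mulg1.
  by rewrite -xy => -[a Aa <-]; rewrite mulKg.
apply/seteqP; split=> z [a Aa <-].
  by exists (y^-1 * x * a); gsimp => //; apply: AM => //; have := AV _ xy; gsimp.
by exists (x^-1 * y * a); gsimp => //; apply: AM.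
Qed.

(** For subgroups, [covered A B n] and [separated A B n] bound the index of [A ∩ B] in [A] by [n]
    from above and from below. The representatives in [covered] may lie outside [A]. *)
Definition covered A B n := exists f : 'I_n -> G, forall a, A a -> exists i, B ((f i)^-1 * a).

Definition separated A B n := exists f : 'I_n -> G,
  (forall i, A (f i)) /\ forall i j, B ((f i)^-1 * f j) -> i = j.

Lemma covered_fin (I : finType) (f : I -> G) A B :
  (forall a, A a -> exists i, B ((f i)^-1 * a)) -> covered A B #|I|.
Proof.
move=> H; exists (fun i => f (enum_val i)) => a /H[i Bi].
by exists (enum_rank i); rewrite enum_rankK.
Qed.

Lemma separated_fin (I : finType) (f : I -> G) A B :
  (forall i, A (f i)) -> (forall i j, B ((f i)^-1 * f j) -> i = j) ->
  separated A B #|I|.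
Proof.
move=> Af H; exists (fun i => f (enum_val i)); split=> // i j /H.
exact: enum_val_inj.
Qed.

Lemma covered_sub A A' B B' n : A' `<=` A -> B `<=` B' ->
  covered A B n -> covered A' B' n.
Proof.
move=> AA BB [f Hf]; exists f => a /AA/Hf[i Bi].
by exists i; apply: BB.
Qed.

Lemma covered_trans B A C m n :
  covered A B m -> covered B C n -> covered A C (m * n).
Proof.
move=> [f Hf] [h Hh]; have -> : (m * n)%N = #|{: 'I_m * 'I_n}| by rewrite card_prod !card_ord.
apply: (@covered_fin _ (fun p => f p.1 * h p.2)) => a /Hf[i /Hh[j Cij]].
by exists (i, j); rewrite /= invgM -mulgA.
Qed.

Lemma coveredU A B C m n :
  covered A C m -> covered B C n -> covered (A `|` B) C (m + n).
Proof.
move=> [f Hf] [h Hh]; have -> : (m + n)%N = #|{: 'I_m + 'I_n}| by rewrite card_sum !card_ord.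
apply: (@covered_fin _ (fun p => match p with inl i => f i | inr j => h j end)) => a.
by case=> [/Hf[i Ci]|/Hh[i Ci]]; [exists (inl i)|exists (inr i)].
Qed.

Lemma covered_le A B m n : (m <= n)%N -> covered A B m -> covered A B n.
Proof.
move=> mn [f Hf]; exists (fun i => oapp f 1 (insub (val i))) => a /Hf[i Bi].
by exists (widen_ord mn i); rewrite /= (valK i).
Qed.

Lemma separated_le A B m n : (m <= n)%N -> separated A B n -> separated A B m.
Proof.
move=> mn [f [Af Hf]]; exists (fun i => f (widen_ord mn i)); split=> // i j /Hf.
by move=> /(congr1 val)/= ij; apply: val_inj.
Qed.

Lemma separated_trans A B C m n : subgroup A -> subgroup B ->
  B `<=` A -> C `<=` B ->
  separated A B m -> separated B C n -> separated A C (m * n).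
Proof.
move=> sA sB BA CB [f [Af Hf]] [h [Bh Hh]].
have -> : (m * n)%N = #|{: 'I_m * 'I_n}| by rewrite card_prod !card_ord.
apply: (@separated_fin _ (fun p => f p.1 * h p.2)) => [[i j]|[i j] [k l]] /=.
  by apply: subgroupM => //; exact/BA.
move=> Hc; have ik : i = k.
  apply: Hf; have := subgroupM sB (subgroupM sB (Bh j) (CB _ Hc)) (subgroupV sB (Bh l)).
  by gsimp.
by rewrite -ik in Hc *; congr pair; apply: Hh; move: Hc; gsimp.
Qed.

Section Pigeonhole.
Variables A B : set G.
Hypothesis sB : subgroup B.

Lemma separated_injection m n (f : 'I_n -> G) (h : 'I_m -> G) :
  (forall j, exists i, B ((f i)^-1 * h j)) ->
  (forall i j, B ((h i)^-1 * h j) -> i = j) ->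
  exists2 s : 'I_m -> 'I_n, injective s & forall j, B ((f (s j))^-1 * h j).
Proof.
move=> /choice[s Hs] Hh; exists s => // i j ij; apply: Hh.
have := subgroupM sB (subgroupV sB (Hs i)) (Hs j).
by rewrite ij; gsimp.
Qed.

Lemma separated_leq_covered m n : covered A B n -> separated A B m -> (m <= n)%N.
Proof.
move=> [f Hf] [h [Ah Hh]].
have [s injs _] := separated_injection (fun j => Hf _ (Ah j)) Hh.
by have := leq_card _ injs; rewrite !card_ord.
Qed.

(** A separated family in [A] of maximal size covers [A], since an element in a new coset could be
    added to it. *)
Lemma covered_transversal n : covered A B n -> exists m (f : 'I_m -> G),
  [/\ forall i, A (f i), forall a, A a -> exists i, B ((f i)^-1 * a) &
      forall i j, B ((f i)^-1 * f j) -> i = j].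
Proof.
move=> cn; pose P := fun m => `[< separated A B m >].
have P0 : exists m, P m.
  by exists 0%N; apply/asboolP; exists (fun i => 1); split=> - [].
have Pn m : P m -> (m <= n)%N by move=> /asboolP /(separated_leq_covered cn).
case: (ex_maxnP P0 Pn) => m /asboolP[f [Af Hf]] maxm.
exists m, f; split=> // a Aa; apply: contrapT => Hn.
have : P m.+1.
  apply/asboolP; rewrite -[m in m.+1]card_ord -card_option.
  apply: (@separated_fin _ (fun o => if o is Some i then f i else a)).
    by case.
  case=> [i|] [j|] //= Bfij; first by rewrite (Hf _ _ Bfij).
    by exfalso; apply: Hn; exists i.
  exfalso; apply: Hn; exists j.
  by have := subgroupV sB Bfij; gsimp.
by move=> /maxm; rewrite ltnn.
Qed.

Lemma covered_exact n : covered A B n -> exists m, covered A B m /\ separated A B m.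
Proof.
by move=> /covered_transversal[m [f [Af Hf fI]]]; exists m; split; exists f.
Qed.

End Pigeonhole.

(** The equality case of the pigeonhole principle: an injection from ['I_n] to itself is a
    bijection. *)
Lemma separated_full A A' B n : subgroup B -> A' `<=` A ->
  covered A B n -> separated A' B n ->
  forall a, A a -> exists2 a', A' a' & B (a'^-1 * a).
Proof.
move=> sB AA [f Hf] [h [Ah Hh]] a /Hf[i Bi].
have [s injs Hs] := separated_injection sB (fun j => Hf _ (AA _ (Ah j))) Hh.
have [t _ st] := injF_bij injs.
exists (h (t i)) => //; have := subgroupM sB (subgroupV sB (Hs (t i))) Bi.
by rewrite st; gsimp.
Qed.

(** [|A : A ∩ D| <= n <= |A : A ∩ B|] leaves no room between [A ∩ D] and [A ∩ B]. *)
Lemma separated_fullI A B D n : subgroup A -> subgroup B -> subgroup D -> D `<=` B ->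
  covered A D n -> separated A B n -> A `&` B `<=` D.
Proof.
move=> sA sB sD DB [f Hf] [h [Ah Hh]] x [Ax Bx].
have [i0 _] := Hf _ (subgroup1 sA).
have [s injs Hs] := separated_injection sD (fun j => Hf _ (Ah j)) (fun i j Dij => Hh i j (DB _ Dij)).
have [t _ st] := injF_bij injs.
have [i Di] := Hf _ (subgroupM sA (Ah i0) Ax).
have Dx : D ((h (t i))^-1 * h i0 * x).
  by have := subgroupM sD (subgroupV sD (Hs (t i))) Di; rewrite st; gsimp.
have ti : t i = i0.
  by apply: Hh; have := subgroupM sB (DB _ Dx) (subgroupV sB Bx); gsimp.
by move: Dx; rewrite ti; gsimp.
Qed.
End Cosets.

(** * Compactness in topological groups *)

Section Compactness.
Variable T : topologicalType.

(** If [Q S] failed, the sets whose complement in [S] satisfies [Q] would form a proper filter; a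
    cluster point of it contradicts the local hypothesis. *)
Lemma compact_local_to_global (S : set T) (Q : set T -> Prop) :
  compact S -> Q set0 -> (forall A B, A `<=` B -> Q B -> Q A) ->
  (forall A B, Q A -> Q B -> Q (A `|` B)) ->
  (forall x, S x -> exists2 U, nbhs x U & Q U) -> Q S.
Proof.
move=> cS Q0 Qsub QU Qloc; apply: contrapT => nQS.
pose F := [set A | Q (S `\` A)].
have FF : ProperFilter F.
  split; first by rewrite /F /= setD0.
  split; rewrite /F /=.
  - by rewrite setDT.
  - by move=> A B QA QB; change (Q (S `\` (A `&` B))); rewrite setDIr; apply: QU.
  - by move=> A B AB; apply: Qsub => x [Sx nB]; split=> // /AB.
have [|x [Sx xF]] := cS F FF; first by rewrite /F /= setDv.
have [U xU QU1] := Qloc x Sx.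
have FU : F (~` U).
  by apply: Qsub QU1 => y [_] /contrapT.
by have [y []] := xF _ _ FU xU.
Qed.

Lemma compact_nested (S : set T) (F : nat -> set T) :
  compact S -> (forall n, F n `<=` S) -> (forall n, closed (F n)) ->
  (forall n, F n.+1 `<=` F n) -> (forall n, F n !=set0) ->
  exists x, forall n, F n x.
Proof.
move=> cS FS cF dF nF.
have [u Fu] := choice nF.
have Fle m n : (m <= n)%N -> F n `<=` F m.
  elim: n => [|n IH]; first by rewrite leqn0 => /eqP ->.
  by rewrite leq_eqVlt => /orP[/eqP -> //|/IH h]; apply: subset_trans h.
have [|x [_ xu]] := cS (u @ \oo) _.
  by exists 0%N => // n _; apply: FS (Fu n).
exists x => n; apply: cF => B xB.
apply: xu xB; exists n => // m /= nm; exact: Fle (Fu m).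
Qed.

End Compactness.

Section TopologicalGroups.
Variable G : topologicalGroupType.
Implicit Types (A B O P U : set G).

Lemma continuous_mulgl (a : G) : continuous (fun x : G => a * x).
Proof.
move=> x; apply: (@continuous_comp _ _ _ (fun y : G => (a, y)) (fun xy : G * G => xy.1 * xy.2)).
  by apply: cvg_pair; [exact: cvg_cst|exact: cvg_id].
exact: mulg_continuous.
Qed.

Lemma continuous_mulgr (a : G) : continuous (fun x : G => x * a).
Proof.
move=> x; apply: (@continuous_comp _ _ _ (fun y : G => (y, a)) (fun xy : G * G => xy.1 * xy.2)).
  by apply: cvg_pair; [exact: cvg_id|exact: cvg_cst].
exact: mulg_continuous.
Qed.

Lemma continuous_conjugation (a : G) : continuous (fun x : G => a * x * a^-1).
Proof.
move=> x; apply: (@continuous_comp _ _ _ (fun y => a * y) (fun y => y * a^-1)).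
  exact: continuous_mulgl.
exact: continuous_mulgr.
Qed.

Lemma open_preimage (f : G -> G) O : continuous f -> open O -> open (f @^-1` O).
Proof. by move=> cf; apply: open_comp => x _; apply: cf. Qed.

Lemma closed_preimage (f : G -> G) O : continuous f -> closed O -> closed (f @^-1` O).
Proof. by move=> cf; apply: preimage_closed. Qed.

Lemma nbhs_leftcoset x O : open O -> subgroup O -> nbhs x [set y | O (x^-1 * y)].
Proof.
move=> oO sO; apply: open_nbhs_nbhs; split.
  exact: (open_preimage (@continuous_mulgl x^-1) oO).
by rewrite /= mulVg; apply: subgroup1.
Qed.

Lemma right_invariant_open P O : open O -> subgroup O ->
  (forall x y, P x -> O y -> P (x * y)) -> open P.
Proof.
move=> oO sO PO; rewrite openE => x Px.
apply: filterS (nbhs_leftcoset x oO sO) => y /= /(PO _ _ Px).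
by gsimp; rewrite ?mulVKg.
Qed.

Lemma right_invariant_closed P O : open O -> subgroup O ->
  (forall x y, P x -> O y -> P (x * y)) -> closed P.
Proof.
move=> oO sO PO; rewrite -openC; apply: (right_invariant_open oO sO) => x y nPx Oy /=.
by move=> Pxy; apply: nPx; have := PO _ _ Pxy (subgroupV sO Oy); gsimp.
Qed.

Lemma open_subgroup_closed O : open O -> subgroup O -> closed O.
Proof. by move=> oO sO; apply: (right_invariant_closed oO sO) => x y; apply: subgroupM. Qed.

Lemma compact_covered A O : compact A -> open O -> subgroup O -> exists n, covered A O n.
Proof.
move=> cA oO sO.
apply: (compact_local_to_global (Q := fun A => exists n, covered A O n)) => //.
- by exists 0%N, (fun=> 1) => x [].
- by move=> B C BC [n cn]; exists n; apply: covered_sub cn.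
- by move=> B C [m cm] [n cn]; exists (m + n)%N; apply: coveredU.
- move=> x _; exists [set y | O (x^-1 * y)]; first exact: nbhs_leftcoset.
  by exists 1%N, (fun=> x) => y Oy; exists ord0.
Qed.

Definition setmulg A B : set G := [set x | exists a b, [/\ A a, B b & x = a * b]].

Lemma compact_setmulg A B : compact A -> compact B -> compact (setmulg A B).
Proof.
move=> cA cB; have -> : setmulg A B = (fun xy : G * G => xy.1 * xy.2) @` (A `*` B).
  apply/seteqP; split=> x.
    by move=> [a [b [Aa Bb ->]]]; exists (a, b).
  by move=> [[a b] [/= Aa Bb] <-]; exists a, b.
apply: continuous_compact; last exact: compact_setX.
by apply: continuous_subspaceT; exact: mulg_continuous.
Qed.

Lemma covered_compact A O n : compact O -> closed A -> covered A O n -> compact A.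
Proof.
move=> cO clA [f Hf].
apply: (subclosed_compact clA (@compact_setmulg (range f) O _ cO)).
  by apply: finite_compact; apply: finite_image; exact: finite_finset.
move=> a /Hf[i Oi]; exists (f i), ((f i)^-1 * a).
by split; [exists i|exact: Oi|gsimp; rewrite ?mulgA ?mulVKg].
Qed.

End TopologicalGroups.

(** * Tidiness above *)

(* The action of the powers of a topological automorphism [alpha = a 1]; the
   inverse automorphism is handled by [zopp]. *)
Record zaction (G : topologicalGroupType) := ZAction {
  zact :> int -> G -> G;
  zact0 : forall x, zact 0%R x = x;
  zactD : forall m n x, zact (m + n)%R x = zact m (zact n x);
  zactM : forall m x y, zact m (x * y) = zact m x * zact m y;
  zact_continuous : forall m, continuous (zact m) }.

Section TidyAbove.
Variables (G : topologicalGroupType).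
Implicit Types (a : zaction G) (A B O V : set G) (x y : G) (m n k : nat).

Fact zopp_subproof0 a x : a (- 0)%R x = x.
Proof. by rewrite oppr0 zact0. Qed.

Fact zopp_subproofD a (m n : int) x : a (- (m + n))%R x = a (- m)%R (a (- n)%R x).
Proof. by rewrite opprD zactD. Qed.

Definition zopp a : zaction G := @ZAction G (fun n : int => a (- n)%R)
  (zopp_subproof0 a) (zopp_subproofD a) (fun n : int => @zactM _ a (- n)%R)
  (fun n : int => @zact_continuous _ a (- n)%R).

Variable a : zaction G.

Lemma zact1 (m : int) : a m 1 = 1.
Proof. by apply: (mulgI (a m 1)); rewrite -zactM !mulg1. Qed.

Lemma zactV (m : int) x : a m x^-1 = (a m x)^-1.
Proof. by apply: (mulgI (a m x)); rewrite -zactM !mulgV zact1. Qed.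

Lemma zactK (m : int) x : a (- m)%R (a m x) = x.
Proof. by rewrite -zactD addNr zact0. Qed.

Lemma zactKV (m : int) x : a m (a (- m)%R x) = x.
Proof. by rewrite -zactD subrr zact0. Qed.

(* The image [alpha ^ m (A)]. *)
Definition zimage (m : int) A := [set x | A (a (- m)%R x)].

(* The intersection of the sets [alpha ^ i (A)] for [0 <= i <= n]. *)
Definition meet A n := [set x | forall i, (i <= n)%N -> A (a (- i%:Z)%R x)].

(* The sets V_+, V_- and V_0 of the theory of tidy subgroups. *)
Definition plus_part A := [set x | forall i, A (a (- i%:Z)%R x)].
Definition minus_part A := [set x | forall i : nat, A (a i x)].
Definition core A := [set x | forall m : int, A (a m x)].

Lemma subgroup_zimage (m : int) A : subgroup A -> subgroup (zimage m A).
Proof.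
move=> [A1 AM AV]; split; rewrite /zimage /=.
- by rewrite zact1.
- by move=> x y; rewrite zactM; apply: AM.
- by move=> x; rewrite zactV; apply: AV.
Qed.

Lemma subgroup_family (I : Type) (P : I -> Prop) (e : I -> int) A : subgroup A ->
  subgroup [set x | forall j, P j -> A (a (e j) x)].
Proof.
move=> [A1 AM AV]; split=> /=.
- by move=> i _; rewrite zact1.
- by move=> x y Ax Ay i Pi; rewrite zactM; apply: AM; [apply: Ax|apply: Ay].
- by move=> x Ax i Pi; rewrite zactV; apply/AV/Ax.
Qed.

Lemma closed_family (I : Type) (P : I -> Prop) (e : I -> int) A : closed A ->
  closed [set x | forall j, P j -> A (a (e j) x)].
Proof.
move=> clA x clx i Pi; apply: (closed_preimage (@zact_continuous _ a (e i)) clA).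
by move=> B /clx[y [Ay By]]; exists y; split=> //; apply: Ay.
Qed.

Lemma subgroup_meet A n : subgroup A -> subgroup (meet A n).
Proof. exact: subgroup_family. Qed.

Lemma subgroup_core A : subgroup A -> subgroup (core A).
Proof.
by move=> /(subgroup_family xpredT id); congr subgroup; apply/seteqP; split=> x h i //; apply: h.
Qed.

Lemma closed_core A : closed A -> closed (core A).
Proof.
move=> clA; rewrite (_ : core A = [set x | forall m : int, True -> A (a m x)]).
  exact: (@closed_family _ (fun=> True) id).
by apply/seteqP; split=> x h i //; apply: h.
Qed.

Lemma core_zact A (m : int) x : core A x -> core A (a m x).
Proof. by move=> Ax k; rewrite -zactD. Qed.

Lemma core_sub A : core A `<=` A.
Proof. by move=> x /(_ 0%R); rewrite zact0. Qed.

Lemma meet_sub A n : meet A n `<=` A.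
Proof. by move=> x /(_ 0%N isT); rewrite oppr0 zact0. Qed.

Lemma plus_part_sub A : plus_part A `<=` A.
Proof. by move=> x /(_ 0%N); rewrite oppr0 zact0. Qed.

Lemma minus_part_sub A : minus_part A `<=` A.
Proof. by move=> x /(_ 0%N); rewrite zact0. Qed.

Lemma meet_meet A m n : meet (meet A m) n = meet A (m + n).
Proof.
apply/seteqP; split=> x Ax i.
  (* With truncated subtraction, [i = (i - m) + minn i m]. *)
  move=> imn; have := Ax (i - m)%N; rewrite leq_subLR => /(_ imn (minn i m)) /=.
  by rewrite geq_minr => /(_ isT); rewrite -zactD; congr (A (a _ x)); lia.
move=> il j jm /=; rewrite -zactD; have := Ax (i + j)%N.
by rewrite (_ : (- j%:Z - i%:Z = - (i + j)%N%:Z)%R); [apply; lia|lia].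
Qed.

Lemma open_family n (e : nat -> int) A : open A ->
  open [set x | forall i, (i <= n)%N -> A (a (e i) x)].
Proof.
move=> oA; have oP i : open [set x | A (a (e i) x)].
  exact: (open_preimage (@zact_continuous _ a (e i)) oA).
elim: n => [|n IH].
  rewrite (_ : [set x | _] = [set x | A (a (e 0%N) x)]) //.
  by apply/seteqP; split=> x /= Ax; [apply: Ax|move=> i; rewrite leqn0 => /eqP ->].
rewrite (_ : [set x | _] = [set x | forall i, (i <= n)%N -> A (a (e i) x)] `&`
    [set x | A (a (e n.+1) x)]); first exact: openI.
apply/seteqP; split=> x /=.
  by move=> Ax; split=> [i /leqW|]; apply: Ax.
by move=> [Ax An] i; rewrite leq_eqVlt => /orP[/eqP ->//|]; apply: Ax.
Qed.

Lemma open_zimage (m : int) A : open A -> open (zimage m A).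
Proof. exact: (open_preimage (@zact_continuous _ a (- m)%R)). Qed.

Lemma compact_zimage (m : int) A : compact A -> compact (zimage m A).
Proof.
move=> cA; have -> : zimage m A = a m @` A.
  apply/seteqP; split=> x; first by move=> Ax; exists (a (- m)%R x); rewrite ?zactKV.
  by move=> [y Ay <-]; rewrite /zimage /= zactK.
by apply: continuous_compact cA; apply: continuous_subspaceT; exact: zact_continuous.
Qed.

Lemma covered_zimage (m : int) A B n : covered A B n -> covered (zimage m A) (zimage m B) n.
Proof.
move=> [f Hf]; exists (fun i => a m (f i)) => x /Hf[i Bi]; exists i.
by rewrite /zimage /= zactM zactV zactK.
Qed.

(* The factorisation [V = (V ∩ ... ∩ alpha^n V) (V ∩ alpha^-1 V)] for all n. *)
Definition tidy_above V := forall n x, V x ->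
  exists2 d, meet V n d & V (a 1%R (d^-1 * x)).

(** Elements of [alpha (meet V n)] lie in [alpha ^ i (V)] for [1 <= i <= n + 1], so if congruent
    modulo [V] they are congruent modulo [meet V n]. Thus [alpha (meet V n)] meets [k] cosets of
    [V], hence all those met by [alpha (V)]. *)
Lemma tidy_above_of_separated V k : subgroup V ->
  covered (zimage 1%R V) V k ->
  (forall n, separated (zimage 1%R (meet V n)) (meet V n) k) -> tidy_above V.
Proof.
move=> sV cV sepV n x Vx.
have sep' : separated (zimage 1%R (meet V n)) V k.
  have [f [Af Hf]] := sepV n; exists f; split=> // i j Vij; apply: Hf => -[|l] ln.
    by rewrite oppr0 zact0.
  rewrite zactM zactV; apply: subgroupM => //; first apply: subgroupV => //.
  - by have := Af i l (ltnW ln); rewrite -zactD; congr (V (a _ _)); lia.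
  - by have := Af j l (ltnW ln); rewrite -zactD; congr (V (a _ _)); lia.
have sub : zimage 1%R (meet V n) `<=` zimage 1%R V by move=> y /meet_sub.
have [|d' d'V dx] := separated_full sV sub cV sep' (a := a 1%R x).
  by rewrite /zimage /= zactK.
by exists (a (-1)%R d') => //; rewrite zactM zactV zactKV.
Qed.

(** [N] is chosen so that the index of [meet V N] under [alpha] is least; it cannot drop from [N] to
    [N + n], as [tidy_above_of_separated] requires. *)
Lemma tidy_above_meet V : subgroup V ->
  (forall n, exists k, covered (zimage 1%R (meet V n)) (meet V n) k) ->
  exists N, tidy_above (meet V N).
Proof.
move=> sV cV; pose P k := `[< exists n, covered (zimage 1%R (meet V n)) (meet V n) k /\
  separated (zimage 1%R (meet V n)) (meet V n) k >].
have exactV n : exists k, covered (zimage 1%R (meet V n)) (meet V n) k /\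
    separated (zimage 1%R (meet V n)) (meet V n) k.
  by have [k ck] := cV n; apply: covered_exact ck; exact: subgroup_meet.
have exP : exists k, P k by have [k Hk] := exactV 0%N; exists k; apply/asboolP; exists 0%N.
case: (ex_minnP exP) => k /asboolP[N [cN _]] mink.
exists N; apply: (tidy_above_of_separated (subgroup_meet N sV) cN) => n.
rewrite meet_meet; have [l [cl sl]] := exactV (N + n)%N.
by apply: separated_le (sl); apply: mink; apply/asboolP; exists (N + n)%N.
Qed.

(** Induction on [k]: the correction is [alpha ^ -k (e)] with [e] in [meet V (n + k)]. Its images
    under [alpha ^ j] for [- n <= j <= k] stay in [V], so the conditions already reached survive. *)
Lemma tidy_above_finite V n k x : subgroup V -> tidy_above V -> V x ->
  exists2 d, meet V n d & forall i, (i <= k)%N -> V (a i (d^-1 * x)).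
Proof.
move=> sV tV Vx; elim: k => [|k [d dV wV]].
  have [d dV _] := tV n x Vx; exists d => // i; rewrite leqn0 => /eqP ->.
  by rewrite zact0; apply: subgroupM => //; apply: subgroupV => //; apply: meet_sub dV.
have [e eV uV] := tV (n + k)%N _ (wV k (leqnn k)).
have eV' (j : int) : (- n%:Z <= j <= k%:Z)%R -> V (a j (a (- k%:Z)%R e)).
  move=> jn; rewrite -zactD; have := eV `|(k%:Z - j)%R|%N.
  by rewrite (_ : (- `|(k%:Z - j)%R|%N%:Z = j - k%:Z)%R); [apply; lia|lia].
exists (d * a (- k%:Z)%R e).
  move=> i il; rewrite zactM; apply: subgroupM => //; first exact: dV.
  by apply: eV'; lia.
move=> i; rewrite leq_eqVlt => /orP[/eqP ->|ik]; last first.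
  rewrite invgM -mulgA zactM zactV; apply: subgroupM => //; last exact: wV.
  by apply: subgroupV => //; apply: eV'; lia.
move: uV; rewrite !zactM zactV -!zactD invgM !zactM !zactV -!zactD -!mulgA.
rewrite (_ : (k.+1%:Z - k%:Z = 1)%R); last by lia.
by rewrite (_ : (1 + k%:Z = k.+1%:Z)%R); last by lia.
Qed.

(** This is [V = V_+ V_-], obtained from the finite factorisations by compactness. *)
Lemma tidy_above_factor V x : subgroup V -> compact V -> closed V ->
  tidy_above V -> V x -> exists2 d, plus_part V d & minus_part V (d^-1 * x).
Proof.
move=> sV cV clV tV Vx.
pose F n := [set d | meet V n d /\ forall i, (i <= n)%N -> V (a i (d^-1 * x))].
have [|n|n d [dV wV]|n|d Fd] := @compact_nested _ V F cV.
- by move=> n d [/meet_sub].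
- apply: (@closedI _ (meet V n) [set d | forall i, (i <= n)%N -> V (a i (d^-1 * x))]).
    exact: closed_family.
  have cdx : continuous (fun d : G => d^-1 * x).
    move=> d; apply: (@continuous_comp _ _ _ (fun d : G => d^-1) (fun y => y * x)).
      exact: invg_continuous.
    exact: continuous_mulgr.
  apply: (closed_preimage (O := [set y | forall i, (i <= n)%N -> V (a i y)]) cdx).
  exact: closed_family.
- by split=> i il; [apply: dV|apply: wV]; apply: leqW.
- by have [d dV wV] := tidy_above_finite n n sV tV Vx; exists d.
exists d; first by move=> i; apply: (Fd i).1.
by move=> i; apply: (Fd i).2.
Qed.
End TidyAbove.

(** * Growth of indices *)

(** If [0 < m < S], Bernoulli's inequality [bern] with [k = c * m] contradicts the bound at exponent
    [c * m + 1]. *)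
Lemma leq_of_expn_bound (S m c : nat) :
  (forall k, (S ^ k <= c * m ^ k)%N) -> (S <= m)%N.
Proof.
move=> H; rewrite leqNgt; apply/negP => mS.
have bern k : (m ^ k.+1 + k.+1 * m ^ k <= m.+1 ^ k.+1)%N.
  elim: k => [|k IH]; first by rewrite expn1 expn0; lia.
  have := leq_mul (leqnn m.+1) IH; rewrite -expnS => /(leq_trans _); apply.
  by rewrite !expnS; nia.
have [m0|m0] := posnP m.
  by have := H 1%N; rewrite m0 !expn1 muln0; lia.
have := H (c * m).+1; have := bern (c * m)%N; rewrite leqNgt => /negP nlt Hc; apply: nlt.
apply: leq_ltn_trans (leq_trans _ Hc) _; first by rewrite leq_exp2r.
have : (0 < m ^ (c * m))%N by rewrite expn_gt0 m0.
by rewrite expnS; nia.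
Qed.

Section Growth.
Variables (G : topologicalGroupType) (a : zaction G).
Implicit Types (A B O U V T : set G) (x y : G).

Lemma zimage_zimage (m n : int) A : zimage a m (zimage a n A) = zimage a (m + n)%R A.
Proof.
by apply/seteqP; split=> x; rewrite /zimage /= -zactD; congr (A (a _ x)); lia.
Qed.

Lemma zimage0 A : zimage a 0 A = A.
Proof. by apply/seteqP; split=> x; rewrite /zimage /= oppr0 zact0. Qed.

Lemma separated_zimage (m : int) A B n :
  separated A B n -> separated (zimage a m A) (zimage a m B) n.
Proof.
move=> [f [Af Hf]]; exists (fun i => a m (f i)); split=> [i|i j].
  by rewrite /zimage /= zactK.
by rewrite /zimage /= zactM zactV !zactK; apply: Hf.
Qed.

Lemma compact_open_meet V n : compact_open_subgroup V -> compact_open_subgroup (meet a V n).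
Proof.
move=> [sV cV oV]; split; first exact: subgroup_meet.
  apply: (subclosed_compact _ cV); last exact: meet_sub.
  by apply: closed_family; exact: open_subgroup_closed.
exact: open_family.
Qed.

Lemma compact_open_covered U V m : compact_open_subgroup U -> compact_open_subgroup V ->
  exists n, covered (zimage a m U) V n.
Proof.
move=> [_ cU _] [sV _ oV]; apply: compact_covered => //; exact: compact_zimage.
Qed.

(** In the theory of tidy subgroups, the closure of this group is adjoined to make a subgroup tidy
    below. *)
Definition homoclinic V := [set x | exists N : nat, forall n : nat, (N <= n)%N ->
  V (a n x) /\ V (a (- n%:Z)%R x)].

Lemma subgroup_homoclinic V : subgroup V -> subgroup (homoclinic V).
Proof.
move=> [V1 VM VV]; split.
- by exists 0%N => n _; rewrite !zact1.
- move=> x y [M HM] [N HN]; exists (maxn M N) => n; rewrite geq_max => /andP[Mn Nn].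
  by rewrite !zactM; split; apply: VM; [apply: (HM _ Mn).1|apply: (HN _ Nn).1|apply: (HM _ Mn).2|apply: (HN _ Nn).2].
- by move=> x [N HN]; exists N => n Nn; rewrite !zactV; split; apply: VV; [apply: (HN _ Nn).1|apply: (HN _ Nn).2].
Qed.

Lemma homoclinic_zact V (m : int) x : homoclinic V x -> homoclinic V (a m x).
Proof.
move=> [N HN]; exists (N + `|m|)%N => n Nn; rewrite -!zactD; split.
  have [|+ _] := HN `|(n%:Z + m)%R|%N; first by lia.
  by rewrite (_ : (`|(n%:Z + m)%R|%N%:Z = n%:Z + m)%R) //; lia.
have [|_] := HN `|(- n%:Z + m)%R|%N; first by lia.
by rewrite (_ : (- `|(- n%:Z + m)%R|%N%:Z = - n%:Z + m)%R) //; lia.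
Qed.

Lemma homoclinic_sub U V : U `<=` V -> homoclinic U `<=` homoclinic V.
Proof. by move=> UV x [N HN]; exists N => n /HN[? ?]; split; apply: UV. Qed.

(* Modulo [V], the elements of [alpha (V_+)] that are homoclinic have finitely
   many homoclinic representatives [f i]; if [alpha ^ n (f i)] lies in [V] for
   [n >= N], every homoclinic element lies in [V alpha ^ N (V)]. *)
Lemma homoclinic_covered V : compact_open_subgroup V ->
  exists k, covered (homoclinic V) V k.
Proof.
move=> cosV; have [sV cV oV] := cosV.
pose B := homoclinic V `&` zimage a 1 (plus_part a V).
have sE := subgroup_homoclinic sV.
have [n0 cn0] := compact_open_covered 1 cosV cosV.
have cB : covered B V n0.
  by apply: covered_sub cn0 => // x [_]; apply: plus_part_sub.
have [k [f [Bf Hf _]]] := covered_transversal sV cB.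
have /choice[e He] (i : 'I_k) := (Bf i).1.
pose N := (\max_i e i)%N.
have fN (i : 'I_k) (n : nat) : (N <= n)%N -> V (a n (f i)).
  by move=> Nn; apply: (He i n _).1; apply: leq_trans Nn; apply: leq_bigmax.
(* The induction removes [u = alpha ^ (N + n) (f i)], whose forward orbit lies in [V] by the choice
   of [N]; what remains lies in [alpha ^ (N + n) (V_+)]. *)
have key (n : nat) x : homoclinic V x -> plus_part a V (a (- (N + n)%N%:Z)%R x) ->
    exists2 w, minus_part a V w & plus_part a V (a (- N%:Z)%R (w^-1 * x)).
  elim: n x => [|n IH] x Ex Px.
    exists 1; first by move=> i; rewrite zact1; apply: subgroup1.
    by move: Px; rewrite addn0 invg1 mul1g.
  have [|i Vi] := Hf (a (- (N + n)%N%:Z)%R x).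
    split; first exact: homoclinic_zact.
    by move: Px; rewrite /zimage /= -zactD; congr (plus_part a V (a _ x)); lia.
  pose u := a (N + n)%N (f i).
  have [||w Vw Pw] := IH (u^-1 * x).
  - apply: subgroupM => //; apply: subgroupV => //; apply: homoclinic_zact.
    exact: (Bf i).1.
  - rewrite zactM zactV zactK => -[|j]; first by rewrite oppr0 zact0.
    rewrite zactM zactV; apply: subgroupM => //; first apply: subgroupV => //.
      have := (Bf i).2 j; rewrite -zactD; congr (V (a _ _)); lia.
    by have := Px j; rewrite -!zactD; congr (V (a _ _)); lia.
  exists (u * w).
    move=> j; rewrite zactM; apply: subgroupM => //.
    by rewrite /u -zactD (_ : (j%:Z + (N + n)%N%:Z = (j + (N + n))%N%:Z)%R); [apply: fN; lia|lia].
  by rewrite invgM -mulgA.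
have [n cn] : exists n, covered (setmulg V (zimage a N V)) V n.
  by apply: compact_covered => //; apply: compact_setmulg => //; exact: compact_zimage.
exists n; apply: covered_sub cn => // x Ex.
have [M HM] := Ex.
have [|w Vw Pw] := key M x Ex.
  by move=> j; rewrite -zactD (_ : (- j%:Z + - (N + M)%N%:Z = - (j + (N + M))%N%:Z)%R); [apply: (HM _ _).2; lia|lia].
exists w, (w^-1 * x); split; [exact: minus_part_sub Vw|exact: plus_part_sub Pw|].
by rewrite mulVKg.
Qed.

End Growth.

(** * Existence of a compact open subgroup with multiplicative indices *)

Section TidyExistence.
Variables (G : topologicalGroupType) (a : zaction G).
Implicit Types (A B O U V T E : set G) (x y : G).

(** [U] is the intersection of the conjugates [e V e^-1]. These depend only on the coset [e V], so
    finitely many suffice and [U] is open. *)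
Lemma normal_core_compact_open V E k : compact_open_subgroup V -> subgroup E ->
  covered E V k ->
  exists U, [/\ compact_open_subgroup U, U `<=` V & forall e x, E e -> U x -> U (e^-1 * x * e)].
Proof.
move=> [sV cV oV] sE cE.
have [m [f [Ef Hf _]]] := covered_transversal sV cE.
pose U := [set x | forall e, E e -> V (e^-1 * x * e)].
have sU : subgroup U.
  split.
  - by move=> e _; gsimp; apply: subgroup1.
  - move=> x y Ux Uy e Ee; have := subgroupM sV (Ux e Ee) (Uy e Ee).
    by gsimp.
  - by move=> x Ux e Ee; have := subgroupV sV (Ux e Ee); gsimp.
have UV : U `<=` V by move=> x /(_ 1 (subgroup1 sE)); gsimp.
have fU x : (forall i, V ((f i)^-1 * x * f i)) -> U x.
  move=> Hx e /Hf[i Vi].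
  by have := subgroupM sV (subgroupM sV (subgroupV sV Vi) (Hx i)) Vi; gsimp.
have oU : open U.
  have oV1 : open [set x | forall i, V ((f i)^-1 * x * f i)].
    rewrite openE => x Vx; apply: filter_forall => i.
    apply: open_nbhs_nbhs; split; last exact: Vx.
    by have := open_preimage (@continuous_conjugation G (f i)^-1) oV; rewrite invgK.
  rewrite (_ : U = [set x | forall i, V ((f i)^-1 * x * f i)]) //.
  by apply/seteqP; split=> // x Ux i; apply: Ux.
exists U; split=> //.
  split=> //; apply: subclosed_compact cV UV; exact: open_subgroup_closed.
move=> e x Ee Ux e' Ee'; have := Ux (e * e') (subgroupM sE Ee Ee').
by gsimp.
Qed.

Lemma homoclinic_normalizes_meet U E N : subgroup E ->
  (forall (m : int) e, E e -> E (a m e)) ->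
  (forall e x, E e -> U x -> U (e^-1 * x * e)) ->
  forall e x, E e -> meet a U N x -> meet a U N (e^-1 * x * e).
Proof.
move=> sE Ea EU e x Ee Ux i iN; rewrite !zactM zactV.
by apply: EU; [exact: Ea|exact: Ux].
Qed.

Section Product.
Variables (T E : set G).
Hypotheses (cosT : compact_open_subgroup T) (sE : subgroup E).
Hypothesis ET : forall e x, E e -> T x -> T (e^-1 * x * e).

Lemma setmulg_subgroup : subgroup (setmulg T E).
Proof.
have [sT _ _] := cosT; split.
- by exists 1, 1; split; rewrite ?mulg1 //; apply: subgroup1.
- move=> _ _ [t [e [Tt Ee ->]]] [t' [e' [Tt' Ee' ->]]].
  exists (t * (e * t' * e^-1)), (e * e'); split.
  + apply: subgroupM => //; have := ET (subgroupV sE Ee) Tt'; by gsimp.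
  + exact: subgroupM.
  + by gsimp.
- move=> _ [t [e [Tt Ee ->]]]; exists (e^-1 * t^-1 * e), e^-1; split.
  + by apply: ET => //; apply: subgroupV.
  + exact: subgroupV.
  + by gsimp.
Qed.

Lemma setmulg_subl : T `<=` setmulg T E.
Proof. by move=> t Tt; exists t, 1; split; rewrite ?mulg1 //; apply: subgroup1. Qed.

Lemma setmulg_compact_open k : covered E T k -> compact_open_subgroup (setmulg T E).
Proof.
have [sT cT oT] := cosT; have sU := setmulg_subgroup.
move=> [f Hf].
have HR x y : setmulg T E x -> T y -> setmulg T E (x * y).
  by move=> Ux Ty; apply: subgroupM => //; apply: setmulg_subl.
split=> //; last exact: (right_invariant_open oT sT HR).
apply: (@covered_compact _ _ _ k cT (right_invariant_closed oT sT HR)).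
exists f => _ [t [e [Tt Ee ->]]].
have [i Ti] := Hf _ Ee; exists i.
by have := subgroupM sT Ti (ET Ee Tt); gsimp.
Qed.

End Product.

Section Multiplicative.
Variable T : set G.
Hypotheses (cosT : compact_open_subgroup T) (tT : tidy_above a T).
Let E := homoclinic a T.
Hypothesis ET : forall e x, E e -> T x -> T (e^-1 * x * e).
Let U := setmulg T E.
(** [H] is the union of the [alpha ^ n (T_+)], and [A] turns out to be [T_+ E]. The indices of [U]
    are computed on [A], which satisfies [A <= alpha (A)]. *)
Let H := [set x | exists N : nat, forall n : nat, (N <= n)%N -> T (a (- n%:Z)%R x)].
Let A := H `&` U.

Let sT : subgroup T. Proof. by case: cosT. Qed.
Let sE : subgroup E. Proof. exact: subgroup_homoclinic. Qed.
Let sU : subgroup U. Proof. exact: setmulg_subgroup. Qed.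

Let sH : subgroup H.
Proof.
have [T1 TM TV] := sT; split.
- by exists 0%N => n _; rewrite zact1.
- move=> x y [M HM] [N HN]; exists (maxn M N) => n; rewrite geq_max => /andP[Mn Nn].
  by rewrite zactM; apply: TM; [apply: HM|apply: HN].
- by move=> x [N HN]; exists N => n Nn; rewrite zactV; apply/TV/HN.
Qed.

Let sA : subgroup A. Proof. exact: subgroupI. Qed.

Let Hz (m : int) x : H x -> H (a m x).
Proof.
move=> [N HN]; exists (N + `|m|)%N => n Nn; rewrite -zactD.
rewrite (_ : (- n%:Z + m = - `|(n%:Z - m)%R|%N%:Z)%R); last by lia.
by apply: HN; lia.
Qed.

Let EH : E `<=` H.
Proof. by move=> x [N HN]; exists N => n /HN[]. Qed.

Let factor x : T x -> exists2 t, plus_part a T t & minus_part a T (t^-1 * x).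
Proof.
have [_ cT oT] := cosT.
by apply: tidy_above_factor => //; exact: open_subgroup_closed.
Qed.

Let plusH : plus_part a T `<=` H.
Proof. by move=> x Px; exists 0%N => n _; apply: Px. Qed.

Let sub_zimage : A `<=` zimage a 1 A.
Proof.
move=> x [Hx [t [e [Tt Ee xte]]]]; split; first exact: Hz.
have [tp Ptp Mtm] := factor Tt.
(* The factor of [t] in [T_-] is a product of elements of [H], hence homoclinic, and is absorbed
   into [E]. *)
have Htm : H (tp^-1 * t).
  apply: subgroupM => //; first by apply: subgroupV => //; exact: plusH.
  rewrite (_ : t = x * e^-1); last by rewrite xte mulgK.
  exact: (subgroupM sH Hx (subgroupV sH (EH Ee))).
have Etm : E (tp^-1 * t).
  have [N HN] := Htm; exists N => n Nn; split; last exact: HN.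
  exact: Mtm.
exists (a (- 1)%R tp), (a (- 1)%R (tp^-1 * t * e)); split.
- exact: (Ptp 1%N).
- by apply: homoclinic_zact; apply: subgroupM.
- by rewrite -zactM xte; gsimp.
Qed.

Let separated_zimageA s : separated (zimage a 1 U) U s -> separated (zimage a 1 A) A s.
Proof.
move=> [f [Uf Hf]].
have /choice[h Hh] i : exists h, zimage a 1 A h /\ U (h^-1 * f i).
  (* In [f i = alpha (tp) alpha (tp^-1 t) alpha (e)] only the first factor matters modulo [U]: the
     second is in [T], the third in [E]. *)
  have [t [e [Tt Ee te]]] := Uf i; have [tp Ptp Mtm] := factor Tt.
  exists (a 1%R tp); split.
    rewrite /zimage /= zactK; split; first exact: plusH.
    by apply: setmulg_subl => //; apply: plus_part_sub Ptp.
  exists (a 1%R (tp^-1 * t)), (a 1%R e); split; first exact: (Mtm 1%N).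
    exact: homoclinic_zact.
  by rewrite -[f i](@zactKV _ a 1%R) te !zactM zactV mulgA.
exists h; split=> [i|i j [_ Uij]]; first by have [] := Hh i.
apply: Hf.
have := subgroupM sU (subgroupM sU (subgroupV sU (Hh i).2) Uij) (Hh j).2.
by gsimp; rewrite ?mulgVK.
Qed.

(** Indices multiply along [A <= alpha (A) <= ... <= alpha ^ n (A)]. Elements of [H] congruent
    modulo [U] are congruent modulo [A], which carries the count back to [U]. *)
Lemma tidy_separated s n : separated (zimage a 1 U) U s ->
  separated (zimage a n%:Z U) U (s ^ n).
Proof.
move=> /separated_zimageA sepA.
have subA m : A `<=` zimage a m%:Z A.
  elim: m => [|m IH]; first by rewrite zimage0.
  move=> x /sub_zimage /IH; rewrite /zimage /= -zactD; congr (A (a _ x)); lia.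
have [f [Af Hf]] : separated (zimage a n%:Z A) A (s ^ n).
  elim: n => [|n IH].
    rewrite expn0; exists (fun=> 1); split=> [i|i j _]; last by rewrite !ord1.
    by rewrite /zimage /= zact1; apply: subgroup1.
  rewrite expnS.
  apply: (@separated_trans _ _ (zimage a n%:Z A)) IH => //; try exact: subgroup_zimage.
    move=> x /sub_zimage; rewrite /zimage /= -!zactD.
    by congr (A (a _ x)); lia.
  have := separated_zimage a n%:Z sepA; rewrite zimage_zimage.
  by rewrite (_ : (n%:Z + 1 = n.+1%:Z)%R) //; lia.
have zA x : zimage a n%:Z A x <-> H x /\ zimage a n%:Z U x.
  split=> [[Hx Ux]|[Hx Ux]]; split=> //; last exact: Hz.
  by rewrite -[x](@zactKV _ a n%:Z); apply: Hz.
exists f; split=> [i|i j Uij]; first by have /zA[] := Af i.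
apply: Hf; split=> //; have /zA[Hi _] := Af i; have /zA[Hj _] := Af j.
by apply: subgroupM => //; apply: subgroupV.
Qed.
End Multiplicative.
End TidyExistence.

(** * Minimizing subgroups *)

Section Minimizing.
Variables (G : topologicalGroupType) (a : zaction G).
Implicit Types (A B O U V T E : set G) (x y : G).

(* [V] is minimizing and [s] is the scale of the automorphism [a 1]. *)
Definition scale_minimal V (s : nat) := [/\ compact_open_subgroup V,
  covered (zimage a 1 V) V s &
  forall U, compact_open_subgroup U -> separated (zimage a 1 U) U s].

(** [V] is first shrunk to a subgroup normalised by the homoclinic group of [V], then made tidy
    above. Since that group is [alpha]-invariant, [meet] preserves the normalisation. *)
Lemma tidy_separated_exists V s : compact_open_subgroup V ->
  (forall U, compact_open_subgroup U -> separated (zimage a 1 U) U s) ->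
  exists2 U, compact_open_subgroup U &
    forall n : nat, separated (zimage a n%:Z U) U (s ^ n).
Proof.
move=> cosV sepV; have [sV cV oV] := cosV.
have sE := subgroup_homoclinic a sV.
have [k ck] := homoclinic_covered a cosV.
have [V0 [cosV0 V0V EV0]] := normal_core_compact_open cosV sE ck.
have [N tT] : exists N, tidy_above a (meet a V0 N).
  apply: tidy_above_meet; first by case: cosV0.
  by move=> n; apply: compact_open_covered; apply: compact_open_meet.
set T := meet a V0 N in tT.
have cosT : compact_open_subgroup T by apply: compact_open_meet.
have TE : homoclinic a T `<=` homoclinic a V.
  by apply: homoclinic_sub; apply: subset_trans V0V; exact: meet_sub.
have ET e x : homoclinic a T e -> T x -> T (e^-1 * x * e).
  move=> /TE; apply: homoclinic_normalizes_meet => // m e' /= ; exact: homoclinic_zact.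
have [l cl] : exists l, covered V T l.
  by have [? _ ?] := cosT; apply: compact_covered.
have cET : covered (homoclinic a T) T (k * l).
  by apply: covered_sub (covered_trans ck cl).
have sET : subgroup (homoclinic a T) by apply: subgroup_homoclinic; case: cosT.
have cosU := setmulg_compact_open cosT sET ET cET.
exists (setmulg T (homoclinic a T)) => // n.
by apply: tidy_separated => //; apply: sepV.
Qed.

Section Minimal.
Variables (V : set G) (s : nat).
Hypothesis minV : scale_minimal V s.

Let cosV : compact_open_subgroup V. Proof. by case: minV. Qed.
Let sV : subgroup V. Proof. by case: cosV. Qed.

Lemma minimal_tidy_above : tidy_above a V.
Proof.
have [_ cV sepV] := minV.
by apply: (tidy_above_of_separated sV cV) => n; apply: sepV; exact: compact_open_meet.
Qed.

(* The growth of [n |-> |alpha^n U : U ∩ alpha^n U|] does not depend on [U]. *)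
Lemma minimal_separated n : separated (zimage a n%:Z V) V (s ^ n).
Proof.
have [_ cV sepV] := minV.
have [U cosU sepU] := tidy_separated_exists cosV sepV.
have [m0 cm0] := compact_open_covered a n cosV cosV.
have [m [cm sm]] := covered_exact sV cm0.
apply: separated_le (sm).
have [p cp] := compact_open_covered a 0 cosU cosV.
have [q cq] := compact_open_covered a 0 cosV cosU.
rewrite !zimage0 in cp cq.
have cnk k : covered (zimage a (n * k)%N%:Z V) V (m ^ k).
  elim: k => [|k IH]; first by rewrite muln0 zimage0; exists (fun=> 1) => x Vx; exists ord0; gsimp.
  rewrite expnS mulnC; have := covered_zimage a (n * k)%N%:Z cm; rewrite zimage_zimage.
  rewrite (_ : ((n * k)%N%:Z + n%:Z = (n * k.+1)%N%:Z)%R); last by lia.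
  by move=> /covered_trans => /(_ _ _ IH); rewrite mulnC.
(* Here [p] and [q] compare [U] with [V] and do not depend on [k]. *)
apply: (@leq_of_expn_bound _ _ (p * q)) => k.
rewrite -expnM.
have cU : covered (zimage a (n * k)%N%:Z U) U (p * m ^ k * q).
  by apply: covered_trans cq; apply: covered_trans (cnk k); exact: covered_zimage.
rewrite mulnAC; apply: (separated_leq_covered _ cU (sepU _)); by case: cosU.
Qed.

(** Since [alpha (meet V n) ∩ V = meet V (n + 1)], the index of [meet V n] in [alpha ^ n (V)] is at
    most [s ^ n], and that of [V ∩ alpha ^ n (V)] is at least [s ^ n]. *)
Lemma minimal_meet n : zimage a n%:Z V `&` V `<=` meet a V n.
Proof.
have [_ cV _] := minV.
apply: (@separated_fullI _ _ _ _ (s ^ n)); [exact: subgroup_zimage|exact: sV|exact: subgroup_meet|exact: meet_sub| |exact: minimal_separated].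
elim: n => [|n IH].
  rewrite zimage0; exists (fun=> 1) => x Vx; exists ord0; gsimp.
  by move=> i; rewrite leqn0 => /eqP ->; rewrite oppr0 zact0.
have sM := subgroup_zimage a 1 (subgroup_meet a n sV).
have sub1 : zimage a 1 (meet a V n) `<=` zimage a 1 V by move=> x /meet_sub.
have c1 : covered (zimage a 1 (meet a V n)) (meet a V n.+1) s.
  have [m [f [Mf Hf fI]]] := covered_transversal sV (covered_sub sub1 (@subset_refl _ V) cV).
  apply: (@covered_le _ _ _ m).
    apply: (separated_leq_covered sV cV); exists f; split=> // i.
    exact: sub1.
  exists f => x Mx; have [i Vi] := Hf x Mx; exists i => -[_|j jn].
    by rewrite oppr0 zact0.
  have := subgroupM sM (subgroupV sM (Mf i)) Mx => /(_ j jn).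
  by rewrite -zactD; congr (V (a _ _)); lia.
rewrite expnSr; apply: covered_trans c1.
have := covered_zimage a 1 IH; rewrite zimage_zimage.
by rewrite (_ : (1 + n%:Z = n.+1%:Z)%R) //; lia.
Qed.

(** Once the factor in [V_-] is split off, the pigeonhole principle puts some [alpha ^ m (p)] and
    [alpha ^ n (p)], [m < n], in one coset of [V]. Then [minimal_meet] gives first
    [alpha ^ (n - m) (p)] in [V], then [alpha (p)] in [V]. *)
Lemma minimal_bounded x N k : V x ->
  covered [set a n x | n in [set n : nat | (N <= n)%N]] V k -> V (a 1%R x).
Proof.
have [_ cV oV] := cosV => Vx [f Hf].
have [p Vp Vm] := tidy_above_factor sV cV (open_subgroup_closed oV sV) minimal_tidy_above Vx.
suff Vap : V (a 1%R p).
  by rewrite -[x](mulVKg p) zactM; apply: subgroupM => //; apply: (Vm 1%N).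
have covp (n : 'I_k.+1) : exists i, V ((f i)^-1 * a (N + n)%N p).
  have [|i Vi] := Hf (a (N + n)%N x); first by exists (N + n)%N => //=; rewrite leq_addr.
  exists i; have := subgroupM sV Vi (subgroupV sV (Vm (N + n)%N)).
  by rewrite zactM zactV; gsimp.
have /choice[h Hh] := covp.
have /injectivePn[i [j ij hij]] : ~~ injectiveb h.
  by apply/injectiveP => /leq_card; rewrite !card_ord ltnn.
wlog lij : i j ij hij / (i < j)%N.
  move=> W; have [lij|lji|/val_inj eij] := ltngtP i j.
  - exact: (W i j).
  - by apply: (W j i) => //; rewrite eq_sym.
  - by rewrite eij eqxx in ij.
pose m := (N + i)%N; pose n := (N + j)%N.
have mn : (m < n)%N by rewrite ltn_add2l.
have Vy : V ((a m p)^-1 * a n p).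
  by have := subgroupM sV (subgroupV sV (Hh i)) (Hh j); rewrite hij; gsimp.
have plusE (l l' : nat) : (l <= l')%N -> zimage a l' V (a l p).
  move=> ll'; rewrite /zimage /= -zactD.
  by have := Vp (l' - l)%N; congr (V (a _ p)); lia.
have sz (l : int) := subgroup_zimage a l sV.
have Vz : meet a V n ((a m p)^-1 * a n p).
  apply: minimal_meet; split=> //; apply: subgroupM => //.
    by apply: subgroupV => //; apply: plusE; exact: ltnW.
  exact: plusE.
have Vq : V (a (n - m)%N p).
  have := Vz m (ltnW mn); rewrite zactM zactV zactK -zactD => Vq.
  have Vpp := plus_part_sub Vp.
  have := subgroupM sV Vpp Vq; rewrite mulVKg.
  by congr (V (a _ p)); lia.
have : meet a V (n - m) (a (n - m)%N p).
  by apply: minimal_meet; split=> //; rewrite /zimage /= zactK; exact: plus_part_sub.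
move=> /(_ (n - m).-1); rewrite leq_pred => /(_ isT); rewrite -zactD.
by congr (V (a _ p)); lia.
Qed.
End Minimal.
End Minimizing.

(** * Shadowing and uniform contraction *)

Section Shadowing.
Variables (G : topologicalGroupType) (a : zaction G).
Implicit Types (A B O U V T M R W : set G) (x y : G).

(* A pseudo-orbit with errors in [R] is corrected one step at a time: the part
   of the error that [alpha] does not keep in [R] is contracted by the powers
   of [alpha^-1], so removing it does not spoil the previous steps. *)
Lemma shadowing_finite R (m : nat -> G) : subgroup R -> tidy_above a R ->
  (forall n, R ((m n.+1)^-1 * a 1%R (m n))) ->
  forall n, exists x, forall i, (i <= n)%N -> R ((m i)^-1 * a i x).
Proof.
move=> sR tR eR; elim=> [|n [x Hx]].
  exists (m 0%N) => i; rewrite leqn0 => /eqP ->; rewrite zact0 mulVg.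
  exact: subgroup1.
have [d dR wR] := tR n _ (subgroupV sR (Hx n (leqnn n))).
exists (x * a (- n%:Z)%R d) => i; rewrite zactM -zactD leq_eqVlt => /orP[/eqP ->|].
  have := subgroupM sR (eR n) (subgroupV sR wR).
  rewrite -zactV !invgM !invgK !zactM -!zactD (_ : (1 + n%:Z = n.+1%:Z)%R); last by lia.
  rewrite (_ : (n.+1%:Z - n%:Z = 1)%R); last by lia.
  by rewrite zactV; gsimp.
rewrite ltnS => il; rewrite mulgA; apply: subgroupM => //; first exact: Hx.
have := dR (n - i)%N (leq_subr _ _).
by congr (R (a _ d)); lia.
Qed.

(** The forward orbit of [x] approaches the compact group [M], so a pseudo-orbit in [M] follows it.
    The orbit of some [y] in [M] shadows this pseudo-orbit; dividing by it gives [c]. *)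
Lemma shadowing T T' x N : compact_open_subgroup T -> compact_open_subgroup T' ->
  T' `<=` T -> (forall n, (N <= n)%N -> T (a n x)) ->
  exists2 c, core a T c &
    exists N', forall n, (N' <= n)%N -> T' (a n (c * x)).
Proof.
move=> cosT cosT' T'T Tx; have [sT cT oT] := cosT; have [sT' cT' oT'] := cosT'.
have clT := open_subgroup_closed oT sT; have clT' := open_subgroup_closed oT' sT'.
pose M := core a T; have sM : subgroup M by exact: subgroup_core.
have clM : closed M by exact: closed_core.
pose R0 := M `&` T'; have sR0 : subgroup R0 by exact: subgroupI.
(* [R0] need not be open in [G], but it is open in the compact group [M]; coset representatives are
   therefore taken in [M]. *)
have [N1 tR] : exists N1, tidy_above a (meet a R0 N1).
  apply: tidy_above_meet => // n.
  have [_ _ oTn] := compact_open_meet a n cosT'.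
  have [k ck] := compact_covered cT oTn (subgroup_meet a n sT').
  have [l [f [Mf Hf _]]] := covered_transversal (subgroup_meet a n sT')
    (covered_sub (@core_sub _ a T) (@subset_refl _ _) ck).
  exists l, f => y Ry.
  have My : M y by rewrite -[y](@zactKV _ a 1%R); apply: core_zact; exact: (meet_sub Ry).1.
  have [i Ti] := Hf y My; exists i => j jn; split; last exact: Ti.
  exact: (core_zact _ (subgroupM sM (subgroupV sM (Mf i)) My)).
set R := meet a R0 N1 in tR.
have sR : subgroup R by exact: subgroup_meet.
have clR : closed R by apply: closed_family; exact: closedI.
(* The exponents run from 1 to [- N1] because the error of the pseudo-orbit must lie in [meet R0 N1]
   and one of its factors carries an extra [alpha]. *)
pose T2 := [set t | forall i, (i <= N1.+1)%N -> T' (a (1 - i%:Z)%R t)].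
have oT2 : open T2 by exact: open_family.
have sT2 : subgroup T2 by exact: subgroup_family.
pose B k := [set z | forall i : nat, T (a (i%:Z - k%:Z)%R z)].
have oMT : open (setmulg M T2).
  apply: (right_invariant_open oT2 sT2) => _ t [m [t' [Mm Tt' ->]]] Tt.
  by exists m, (t' * t); split; rewrite ?mulgA //; exact: (subgroupM sT2 Tt' Tt).
(* The sets [B k] decrease to [M], so one of them lies in the open set [M T2]. *)
have [k Bk] : exists k, B k `<=` setmulg M T2.
  apply: contrapT => /forallNP nB.
  have [|k|k z [Bz nz]|k|z Fz] := @compact_nested _ T (fun k => B k `&` ~` setmulg M T2) cT.
  - by move=> k z [/(_ k)]; rewrite subrr zact0.
  - apply: closedI; last by rewrite closedC.
    move=> z clz i; apply: (closed_preimage (@zact_continuous _ a (i%:Z - k%:Z)%R) clT).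
    by move=> C /clz[y [By Cy]]; exists y; split=> //; apply: By.
  - by split=> // i; have := Bz i.+1; congr (T (a _ z)); lia.
  - apply: contrapT => nF; have := nB k; apply=> z Bz; apply: contrapT => nz.
    by apply: nF; exists z.
  - have [_] := Fz 0%N; apply; exists z, 1; split; rewrite ?mulg1 //; last exact: (subgroup1 sT2).
    by move=> m; have := (Fz `|m|%N).1 `|(m + `|m|%N%:Z)%R|%N; congr (T (a _ z)); lia.
pose x' := a (N + k)%N x.
have /choice[m Hm] (n : nat) : exists m, M m /\ T2 (m^-1 * a n x').
  have [|m [t [Mm Tt e]]] := Bk (a n x').
    move=> i; rewrite /x' -!zactD.
    by rewrite (_ : (i%:Z - k%:Z + n%:Z + (N + k)%N%:Z = (i + n + N)%N%:Z)%R); [apply: Tx; lia|lia].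
  by exists m; split=> //; rewrite e mulKg.
have T'T2 : T2 `<=` T' by move=> t /(_ 1%N isT); rewrite subrr zact0.
have eR n : R ((m n.+1)^-1 * a 1%R (m n)).
  have [Mn Tn] := Hm n; have [Mn1 Tn1] := Hm n.+1.
  move=> i il; split.
    exact: (core_zact _ (subgroupM sM (subgroupV sM Mn1) (core_zact _ Mn))).
  have -> : (m n.+1)^-1 * a 1%R (m n) =
      ((m n.+1)^-1 * a n.+1 x') * (a 1%R ((m n)^-1 * a n x'))^-1.
    rewrite zactM zactV -zactD (_ : (1 + n%:Z = n.+1%:Z)%R); last by lia.
    by gsimp.
  rewrite zactM zactV -zactD; apply: subgroupM => //; last apply: subgroupV => //.
    by have := Tn1 i.+1; rewrite ltnS => /(_ il); congr (T' (a _ _)); lia.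
  by have := Tn i (leqW il); congr (T' (a _ _)); lia.
have RM : R `<=` M by move=> r /meet_sub[].
have [y Ry] : exists y, forall i : nat, R ((m i)^-1 * a i y).
  pose F n := [set y | forall i, (i <= n)%N -> R ((m i)^-1 * a i y)].
  have [|n|n y Fy i /leqW|n|y Fy] := @compact_nested _ T F cT.
  - move=> n y /(_ 0%N isT)/RM; rewrite zact0 => My.
    by apply: (@core_sub _ a); have := subgroupM sM (Hm 0%N).1 My; rewrite mulVKg.
  - move=> y cly i il.
    have cont : continuous (fun y => (m i)^-1 * a i y).
      move=> z; apply: (@continuous_comp _ _ _ (a i) (fun y => (m i)^-1 * y)).
        exact: zact_continuous.
      exact: continuous_mulgl.
    apply: (closed_preimage cont clR) => C /cly[z [Fz Cz]].
    by exists z; split=> //; exact: Fz.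
  - exact: Fy.
  - exact: shadowing_finite.
  - by exists y => i; exact: (Fy i).
have My : M y.
  by have := subgroupM sM (Hm 0%N).1 (RM _ (Ry 0%N)); rewrite zact0 mulVKg.
exists (a (- (N + k)%N%:Z)%R y^-1).
  exact: (core_zact _ (subgroupV sM My)).
exists (N + k)%N => n Nn.
have -> : a n (a (- (N + k)%N%:Z)%R y^-1 * x) = a (n - (N + k))%N (y^-1 * x').
  rewrite !zactM -!zactD; congr (a _ _ * a _ _); lia.
move: (n - (N + k))%N => {Nn} {}n.
have := subgroupM sT' (subgroupV sT' (meet_sub (Ry n)).2) (T'T2 _ (Hm n).2).
by rewrite zactM zactV; gsimp.
Qed.

(** One application of [shadowing] for each [j] corrects [u j] to [u j.+1]. The cosets
    [core a (T j) (u j)] are nested and compact; a common point replaces the limit of the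
    corrections. *)
Lemma contraction_approximation (T : nat -> set G) x N :
  (forall j, compact_open_subgroup (T j)) -> (forall j, T j.+1 `<=` T j) ->
  (forall n, (N <= n)%N -> T 0%N (a n x)) ->
  exists2 c, core a (T 0%N) c &
    forall j, exists N', forall n, (N' <= n)%N -> T j (a n (c * x)).
Proof.
move=> cosT dT Tx.
pose P j y := exists N', forall n, (N' <= n)%N -> T j (a n y).
have step (p : nat * G) : exists y, P p.1 p.2 ->
    P p.1.+1 y /\ core a (T p.1) (y * p.2^-1).
  case: p => j y /=; have [[N' HN]|nP] := pselect (P j y); last by exists 1.
  have [c cT [N2 HN2]] := shadowing (cosT j) (cosT j.+1) (dT j) HN.
  by exists (c * y) => _; rewrite mulgK; split=> //; exists N2.
have [f Hf] := choice step.
pose u := fix u j := if j is i.+1 then f (i, u i) else x.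
have Pu j : P j (u j) by elim: j => [|j /(Hf (j, u j))[]//]; exists N.
have uS j : core a (T j) (u j.+1 * (u j)^-1) by have [] := Hf (j, u j) (Pu j).
have sT j : subgroup (T j) by case: (cosT j).
have clT j : closed (T j) by have [? _ ?] := cosT j; exact: open_subgroup_closed.
have coredT j : core a (T j.+1) `<=` core a (T j) by move=> y Ty k; apply: dT.
have sC j : subgroup (core a (T j)) by exact: subgroup_core.
have cT0 : compact (setmulg (T 0%N) [set x]).
  by apply: compact_setmulg; [case: (cosT 0%N)|exact: compact_set1].
have down j z : core a (T j.+1) (z * (u j.+1)^-1) -> core a (T j) (z * (u j)^-1).
  by move=> /coredT/(subgroupM (sC j))/(_ (uS j)); gsimp.
have [|j|j z|j|z Fz] := @compact_nested _ _ (fun j => [set z | core a (T j) (z * (u j)^-1)]) cT0.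
- move=> j z /=; elim: j => [|j IH]; last by move/down/IH.
  by move=> /core_sub Tz; exists (z * x^-1), x; split; rewrite ?mulgVK.
- apply: (closed_preimage (@continuous_mulgr _ (u j)^-1)); exact: closed_core.
- exact: down.
- by exists (u j); rewrite /= mulgV; exact: subgroup1.
exists (z * x^-1); first exact: (Fz 0%N).
move=> j; have [N' HN] := Pu j; exists N' => n /HN Tn.
by have := subgroupM (sT j) (Fz j n) Tn; rewrite -zactM !mulgVK.
Qed.

(* A Baire category argument: otherwise there is a nested sequence of nonempty
   closed sets whose common points lie outside infinitely many [S m]. *)
Lemma compact_uniform W (S : nat -> set G) : subgroup W -> compact W -> closed W ->
  (forall m, subgroup (S m)) -> (forall m, open (S m)) ->
  (forall x, W x -> exists N, forall m, (N <= m)%N -> S m x) ->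
  exists N, forall m, (N <= m)%N -> W `<=` S m.
Proof.
move=> sW cW clW sS oS WS; apply: contrapT => nU.
pose F (ms : seq nat) := [set x | W x /\ forall m, m \in ms -> ~ S m x].
have step (p : nat * seq nat) : exists m, F p.2 !=set0 -> (p.1 <= m)%N /\ F (m :: p.2) !=set0.
  case: p => N ms /=; have [[x [Wx Sx]]|n0] := pselect (F ms !=set0); last by exists 0%N.
  apply: contrapT => /forallNP nm; apply: nU.
  have FS m z : (N <= m)%N -> F ms z -> S m z.
    move=> Nm [Wz Sz]; apply: contrapT => nS; apply: (nm m) => _; split=> //.
    by exists z; split=> // m'; rewrite inE => /orP[/eqP -> //|]; exact: Sz.
  (* If no [m] works, [F ms] lies in [S m] for all [m >= N]. It contains [x (W ∩ O)], so [W ∩ O]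
     lies in [S m], and finitely many coset representatives then give all of [W] for large [m]. *)
  pose O := [set y | forall m, m \in ms -> S m y].
  have sO : subgroup O.
    split=> [m _|y z Oy Oz m mms|y Oy m mms]; first exact: subgroup1.
      by apply: subgroupM => //; [exact: Oy|exact: Oz].
    by apply: subgroupV => //; exact: Oy.
  have oO : open O.
    rewrite /O; elim: (ms) => [|m l IH].
      by rewrite (_ : [set y | _] = setT); [exact: openT|apply/seteqP; split].
    rewrite (_ : [set y | _] = S m `&` [set y | forall m, m \in l -> S m y]); first exact: openI.
    apply/seteqP; split=> y.
      by move=> Sy; split=> [|m' m'l]; apply: Sy; rewrite inE ?eqxx ?m'l ?orbT.
    by move=> [Smy Sy] m'; rewrite inE => /orP[/eqP -> //|]; exact: Sy.
  have [k0 ck0] := compact_covered cW oO sO.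
  have [k [f [Wf Hf _]]] := covered_transversal sO ck0.
  have /choice[e He] (i : 'I_k) := WS _ (Wf i).
  exists (maxn N (\max_i e i)) => m; rewrite geq_max => /andP[Nm em] w Ww.
  have [i Oi] := Hf w Ww.
  have Sf : S m (f i) by apply: He; apply: leq_trans em; exact: leq_bigmax.
  rewrite -(mulVKg (f i) w); apply: subgroupM => //.
  rewrite -(mulKg x (_ * _)); apply: subgroupM => //; first by apply: subgroupV => //; apply: FS.
  apply: FS => //; split.
    by apply: subgroupM => //; apply: subgroupM => //; exact: subgroupV.
  move=> m' m'ms Sx'; apply: (Sx m' m'ms).
  by have := subgroupM (sS m') Sx' (subgroupV (sS m') (Oi m' m'ms)); rewrite mulgK.
have [f Hf] := choice step.
pose u := fix u j := if j is i.+1 then f (i, u i) :: u i else [::].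
have nF j : F (u j) !=set0.
  elim: j => [|j /(Hf (j, u j))[]//]; exists 1; split=> //; exact: subgroup1.
have [|j|j z [Wz Sz]|j|x Fx] := @compact_nested _ W (fun j => F (u j)) cW.
- by move=> j z [].
- move=> z clz; split; first by apply: clW => C /clz[y [[Wy _] Cy]]; exists y.
  move=> m mu Smz.
  by have [|y [[_ Sy] Sy']] := clz (S m); [exact: open_nbhs_nbhs|exact: Sy Sy'].
- by split=> // m mu; apply: Sz; rewrite inE mu orbT.
- exact: nF.
have [N HN] := WS x (Fx 0%N).1.
have [le _] := Hf (N, u N) (nF N).
by have [_ /(_ (f (N, u N)))] := Fx N.+1; apply; [rewrite inE eqxx|exact: HN].
Qed.

End Shadowing.

(** * The scale *)

Section Scale.
Variables (G : topologicalGroupType).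
Implicit Types (A B U V : set G) (x g : G) (a : zaction G).

Lemma index_exact A B n : subgroup A -> subgroup B -> covered A B n ->
  covered A B (Defs.index A (B `&` A)) /\ separated A B (Defs.index A (B `&` A)).
Proof.
move=> sA sB /(covered_transversal sB)[m [f [Af Hf fI]]].
have sBA := subgroupI sB sA.
suff -> : Defs.index A (B `&` A) = m by split; exists f.
have cardm : ([set leftcoset x (B `&` A) | x in A] #= `I_m)%card.
  have -> : [set leftcoset x (B `&` A) | x in A] =
      (fun i => leftcoset (f i) (B `&` A)) @` [set: 'I_m].
    apply/seteqP; split=> C [x].
      move=> Ax <-; have [i Bi] := Hf x Ax; exists i => //.
      apply/(subgroup_leftcosetP _ _ sBA); split=> //.
      by apply: subgroupM => //; apply: subgroupV.
    by move=> _ <-; exists (f x).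
  apply: card_eq_trans (inj_card_eq _) _; last by rewrite card_eq_sym card_II.
  by move=> i j _ _ /(subgroup_leftcosetP _ _ sBA)[/fI].
apply: xget_unique => //= k cardk; apply/esym/card_eq_II.
by apply: card_eq_trans cardk; rewrite card_eq_sym.
Qed.

Lemma expgz_sub g (i j : nat) : expgz g (i%:Z - j%:Z)%R = g ^+ i * g ^- j.
Proof.
have [ji|ij] := leqP j i.
  rewrite -{2}(subnK ji) (_ : (i%:Z - j%:Z)%R = Posz (i - j)); last by lia.
  by rewrite expgnDr mulgK.
rewrite (_ : (i%:Z - j%:Z)%R = Negz (j - i).-1); last by lia.
rewrite /expgz prednK ?subn_gt0 // -{2}(subnK (ltnW ij)) expgnDr invgM.
by rewrite mulgA mulgV mul1g.
Qed.

Lemma expgzD g (m n : int) : expgz g (m + n)%R = expgz g m * expgz g n.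
Proof.
have decomp (k : int) : exists i j : nat, k = (i%:Z - j%:Z)%R.
  by case: k => i; [exists i, 0%N|exists 0%N, i.+1]; lia.
have [i [j ->]] := decomp m; have [i' [j' ->]] := decomp n.
rewrite (_ : (i%:Z - j%:Z + (i'%:Z - j'%:Z) = (i + i')%N%:Z - (j' + j)%N%:Z)%R); last by lia.
rewrite !expgz_sub !expgnDr invgM -!mulgA; congr (_ * _); rewrite !mulgA.
have comm (k l : nat) : commute (g ^+ k) (g ^- l).
  by apply/commuteV/commuteX2.
have -> : g ^- j * g ^+ i' = g ^+ i' * g ^- j by rewrite comm.
rewrite -!mulgA; congr (_ * _).
Qed.

Definition conj_zaction_fun g (n : int) x := expgz g n * x * (expgz g n)^-1.

Fact conj_zaction0 g x : conj_zaction_fun g 0 x = x.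
Proof. by rewrite /conj_zaction_fun /= expg0 invg1 mulg1 mul1g. Qed.

Fact conj_zactionD g (m n : int) x :
  conj_zaction_fun g (m + n)%R x = conj_zaction_fun g m (conj_zaction_fun g n x).
Proof. by rewrite /conj_zaction_fun expgzD; gsimp. Qed.

Fact conj_zactionM g (m : int) x y :
  conj_zaction_fun g m (x * y) = conj_zaction_fun g m x * conj_zaction_fun g m y.
Proof. by rewrite /conj_zaction_fun; gsimp. Qed.

Fact conj_zaction_continuous g (m : int) : continuous (conj_zaction_fun g m).
Proof. exact: continuous_conjugation. Qed.

Definition conj_zaction g : zaction G := ZAction (conj_zaction0 g) (conj_zactionD g)
  (conj_zactionM g) (@conj_zaction_continuous g).

Lemma conjset_zimage g U : conjset g U = zimage (conj_zaction g) 1 U.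
Proof.
apply/seteqP; split=> x.
  move=> [u Uu <-]; rewrite /zimage /= /conj_zaction_fun /= expg1.
  by gsimp.
rewrite /zimage /= /conj_zaction_fun /= expg1 invgK => Ux.
by exists (g^-1 * x * g) => //; gsimp.
Qed.

Lemma conjset_zimageV g U : conjset g^-1 U = zimage (zopp (conj_zaction g)) 1 U.
Proof.
apply/seteqP; split=> x.
  move=> [u Uu <-]; rewrite /zimage /= /conj_zaction_fun /= expg1.
  by gsimp.
rewrite /zimage /= /conj_zaction_fun /= expg1 => Ux.
by exists (g * x * g^-1) => //; gsimp.
Qed.

Lemma scale_attained g V : compact_open_subgroup V ->
  (exists U, minimizing g U) /\
  forall U, compact_open_subgroup U -> (scale g <= displacement_index g U)%N.
Proof.
move=> cosV; pose P n := `[< exists2 U, compact_open_subgroup U & displacement_index g U = n >].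
have exP : exists n, P n by exists (displacement_index g V); apply/asboolP; exists V.
case: (ex_minnP exP) => n /asboolP[U cosU Un] minn.
have [[U' cosU' dU'] minU] : (exists2 U, compact_open_subgroup U & displacement_index g U = scale g) /\
    (forall U, compact_open_subgroup U -> (scale g <= displacement_index g U)%N).
  apply: (@xgetPex _ 0%N [set n | (exists2 U, compact_open_subgroup U & displacement_index g U = n) /\
    (forall U, compact_open_subgroup U -> (n <= displacement_index g U)%N)]).
  by exists n; split; [exists U|move=> W cosW; apply: minn; apply/asboolP; exists W].
by split=> //; exists U'.
Qed.

(** The automorphism is left general in order to serve both [g], with [conj_zaction g], and [g^-1],
    with its [zopp]. *)
Lemma scale_minimalP a g V : (forall U, conjset g U = zimage a 1 U) ->
  minimizing g V -> scale_minimal a V (scale g).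
Proof.
move=> ga [cosV dV].
have exact U : compact_open_subgroup U ->
    covered (zimage a 1 U) U (displacement_index g U) /\
    separated (zimage a 1 U) U (displacement_index g U).
  move=> cosU; have [n cn] := compact_open_covered a 1 cosU cosU.
  rewrite /displacement_index ga; case: cosU => sU _ _.
  by apply: index_exact cn => //; exact: subgroup_zimage.
split=> //; first by rewrite -dV; have [] := exact V cosV.
move=> U cosU; apply: separated_le (exact U cosU).2.
exact: (scale_attained g cosV).2.
Qed.

End Scale.

(** * Geodesics *)

Local Open Scope ring_scope.

Section Geodesics.
Variables (R : realType) (X : metricType R).
Implicit Types (x y p q : X) (S C : set X).

Lemma geodesic_segment_dist x y S p : geodesic_segment x y S -> S p ->
  mdist x p + mdist p y = mdist x y.
Proof.
move=> [c [c0 cd cI ->]] [t td <-].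
have d0 : 0 <= mdist x y by exact: mdist_ge0.
have in0 : 0 \in `[0, mdist x y] by rewrite in_itv /= lexx.
have ind : mdist x y \in `[0, mdist x y] by rewrite in_itv /= d0 lexx.
have := cI 0 t in0 td; have := cI t _ td ind.
rewrite c0 cd => -> ->; move: td; rewrite /= in_itv /= => /andP[t0 td].
by rewrite sub0r normrN ger0_norm // ler0_norm ?subr_le0 //; lra.
Qed.

Lemma geodesic_segment_inj x y S p q : geodesic_segment x y S -> S p -> S q ->
  mdist x p = mdist x q -> p = q.
Proof.
move=> [c [c0 cd cI ->]] [t td <-] [u ud <-].
have d0 : 0 <= mdist x y by exact: mdist_ge0.
have in0 : 0 \in `[0, mdist x y] by rewrite in_itv /= lexx.
have := cI 0 t in0 td; have := cI 0 u in0 ud.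
rewrite c0 => -> ->; move: td ud; rewrite /= !in_itv /= => /andP[t0 _] /andP[u0 _].
by rewrite !sub0r !normrN !ger0_norm // => ->.
Qed.

Lemma geodesic_segment_sym x y S : geodesic_segment x y S -> geodesic_segment y x S.
Proof.
move=> [c [c0 cd cI ->]]; exists (fun t => c (mdist x y - t)).
have d0 : 0 <= mdist x y by exact: mdist_ge0.
rewrite (metric_sym y x); split; rewrite ?subr0 ?subrr //.
  move=> s t; rewrite !in_itv /= => /andP[s0 sd] /andP[t0 td].
  rewrite cI ?in_itv /= ?subr_ge0 ?lerBlDr ?lerDl ?s0 ?sd ?t0 ?td //.
  by rewrite opprB addrC addrA subrK distrC.
apply/seteqP; split=> z [t]; rewrite /= in_itv /= => /andP[t0 td] <-.
  exists (mdist x y - t); last by rewrite opprB addrC subrK.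
  by rewrite /= in_itv /= subr_ge0 td lerBlDr lerDl.
exists (mdist x y - t) => //.
by rewrite /= in_itv /= subr_ge0 td lerBlDr lerDl.
Qed.

Lemma geodesic_segment_refl x : geodesic_segment x x [set x].
Proof.
exists (fun=> x); rewrite mdistxx; split=> //.
  move=> s t; rewrite !in_itv /= => /andP[s0 s1] /andP[t0 t1].
  by rewrite (_ : s - t = 0) ?normr0 //; lra.
apply/seteqP; split=> z; first by move=> ->; exists 0; rewrite //= in_itv /= lexx.
by move=> [t _ <-].
Qed.

Lemma geodesic_segment_isometry (f : X -> X) x y S :
  (forall u v, mdist (f u) (f v) = mdist u v) ->
  geodesic_segment x y S -> geodesic_segment (f x) (f y) (f @` S).
Proof.
move=> fI [c [c0 cd cI ->]]; exists (f \o c); rewrite fI; split.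
- by rewrite /= c0.
- by rewrite /= cd.
- by move=> s t /= sd td; rewrite fI cI.
- by rewrite image_comp.
Qed.

(** Comparison in the degenerate triangle [x], [y], [y] with sides [S], the point [y] and [S']: on
    the line, [p] and [q] have the same comparison point. *)
Lemma cat0_geodesic_unique x y S S' p q : cat0 X ->
  geodesic_segment x y S -> geodesic_segment x y S' -> S p -> S' q ->
  mdist x p = mdist x q -> p = q.
Proof.
move=> hcat gS gS' Sp Sq xpq.
have d0 : 0 <= mdist x y by exact: mdist_ge0.
pose d := mdist x y; pose t := mdist x p.
have t0 : 0 <= t by exact: mdist_ge0.
have py : mdist p y = d - t by rewrite -[d](geodesic_segment_dist gS Sp) addrC addKr.
have qy : mdist q y = d - t.
  by rewrite -[d](geodesic_segment_dist gS' Sq) /t xpq addrC addKr.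
have td : 0 <= d - t by rewrite -py; exact: mdist_ge0.
have eucl (u v : R) : eucl_dist (u, 0) (v, 0) = `|u - v|.
  by rewrite /eucl_dist /= subrr expr0n /= addr0 sqrtr_sqr.
have := @hcat x y y S [set y] S'.
move=> /(_ _ (0, 0) (d, 0) (d, 0) _ _ _ p q (t, 0) (t, 0)).
rewrite !eucl mdistxx (subrr d) normr0 => H.
apply: mdist_positivity; apply/eqP; rewrite eq_le mdist_ge0 andbT.
rewrite subrr normr0 in H; apply: H => //.
- by split=> //; [exact: geodesic_segment_refl|exact: geodesic_segment_sym].
- by rewrite sub0r normrN ger0_norm.
- by rewrite subr0 ger0_norm // metric_sym.
- split; rewrite eucl.
    by rewrite sub0r normrN ger0_norm.
  by rewrite py distrC ger0_norm.
- split; rewrite eucl.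
    by rewrite metric_sym qy ger0_norm.
  by rewrite subr0 ger0_norm // metric_sym.
Qed.

End Geodesics.

(** * Contraction groups and fixators *)

Local Open Scope group_scope.

Section Contraction.
Variables (G : topologicalGroupType) (g : G) (O : nat -> set G) (K : set G).
Hypotheses (cosO : forall j, compact_open_subgroup (O j))
  (decO : forall j, O j.+1 `<=` O j) (KO : forall x, K x <-> forall j, O j x).

Let sK : subgroup K.
Proof.
have sO j : subgroup (O j) by case: (cosO j).
split=> [|x y /KO Kx /KO Ky|x /KO Kx]; apply/KO => j.
- exact: subgroup1.
- exact: subgroupM.
- exact: subgroupV.
Qed.

Lemma to_coset_eq x y : to_coset K x = to_coset K y <-> K (x^-1 * y).
Proof.
rewrite -(subgroup_leftcosetP _ _ sK); split=> [/eqmodP/asboolP //|xy].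
by apply/eqmodP/asboolP.
Qed.

(** The image of [O j] in the coset space is open because [O j] is a union of cosets of [K]. By
    compactness of [O 0], each neighbourhood of the base point contains such an image. *)
Lemma conP h : con g K h <->
  forall j, exists N, forall n, (N <= n)%N -> O j (conj_zaction g n h).
Proof.
split=> [hK j|hO].
  have [sO _ oO] := cosO j.
  pose U := [set c : coset_space K | exists2 w, O j w & c = to_coset K w].
  have oU : open U.
    rewrite /open /= /quotient_open.
    rewrite (_ : _ @^-1` U = O j) //; apply/seteqP; split=> x.
      move=> [w Ow /to_coset_eq/(subgroupV sK)/KO/(_ j)].
      by rewrite invgM invgK => /(subgroupM sO Ow); rewrite mulVKg.
    by exists x.
  have U1 : nbhs (to_coset K 1) U.
    by apply: open_nbhs_nbhs; split=> //; exists 1 => //; exact: subgroup1.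
  have [N _ HN] := hK _ U1; exists N => n /HN[w Ow /to_coset_eq/(subgroupV sK)/KO/(_ j)].
  by rewrite invgM invgK => /(subgroupM sO Ow); rewrite mulVKg.
move=> A; rewrite nbhsE => -[B [oB B1] BA].
have [j OB] : exists j, O j `<=` to_coset K @^-1` B.
  apply: contrapT => /forallNP nO.
  have [_ c0 _] := cosO 0%N.
  have [|j|j z [Oz nz]|j|z Fz] := @compact_nested _ (O 0%N) (fun j => O j `&` ~` (to_coset K @^-1` B)) c0.
  - by move=> i z [+ _]; elim: i => [//|i IH /decO].
  - have [sO _ oO] := cosO j.
    apply: closedI; first exact: open_subgroup_closed.
    by rewrite closedC; exact: oB.
  - by split=> //; apply: decO.
  - apply: contrapT => nF; have := nO j; apply=> z Oz; apply: contrapT => nz.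
    by apply: nF; exists z.
  - have [_] := Fz 0%N; apply; rewrite /= (_ : to_coset K z = to_coset K 1) //.
    by apply/to_coset_eq; rewrite mulg1; apply: (subgroupV sK); apply/KO => j; have [] := Fz j.
have [N HN] := hO j; exists N => // n /= Nn; apply: BA; apply: OB.
exact: HN.
Qed.

End Contraction.

(** * Isometric actions: fixed-point sets and fixators of balls *)

Section Action.
Variables (R : realType) (X : metricType R) (G : topologicalGroupType).
Variable act : G -> X -> X.
Hypothesis hact : isometric_action act.
Implicit Types (x y : X) (Y : set X) (W : set G).

Lemma act1 x : act 1 x = x. Proof. by case: hact. Qed.
Lemma actM (g h : G) x : act (g * h) x = act g (act h x). Proof. by case: hact. Qed.
Lemma act_dist (g : G) x y : mdist (act g x) (act g y) = mdist x y. Proof. by case: hact. Qed.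
Lemma actK (g : G) x : act g^-1 (act g x) = x. Proof. by rewrite -actM mulVg act1. Qed.
Lemma actKV (g : G) x : act g (act g^-1 x) = x. Proof. by rewrite -actM mulgV act1. Qed.

Lemma subgroup_fixator Y : subgroup (fixator act Y).
Proof.
split=> [y _|g h gY hY y Yy|g gY y Yy]; first exact: act1.
  by rewrite actM hY // gY.
by rewrite -{1}(gY y Yy) actK.
Qed.

Lemma closed_fixed_points W : closed (fixed_points act W).
Proof.
move=> x clx w Ww; apply: mdist_positivity; apply/eqP; rewrite eq_le mdist_ge0 andbT.
apply/ler_addgt0Pl => e e0; rewrite addr0.
have [|z [Wz]] := clx (ball x (e / 2)%R); first by apply: nbhsx_ballx; rewrite divr_gt0.
rewrite ballEmdist /= => xz.
have := metric_triangle (act w x) (act w z) x; rewrite act_dist (Wz _ Ww) (metric_sym z).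
by move=> /le_trans; apply; rewrite [leRHS]splitr lerD // ltW.
Qed.

(** Each [w] maps geodesics from [x] to [y] to such geodesics. In the CAT(0) case uniqueness
    concludes. Otherwise [p], common to [S] and [w S], is [w q] with [q] in [S] at the same distance
    from [x], so [q = p]. *)
Lemma convex_fixed_points W Y : npc_space X -> convex_subset Y ->
  convex_subset (fixed_points act W `&` Y).
Proof.
move=> hX [Y1 Y2].
have geoX : geodesic_space X by case: hX => -[].
split=> [hc x y S [xW Yx] [yW Yy] gS p Sp|x y p [xW Yx] [yW Yy] Sp].
  split; last exact: Y1 gS _ Sp.
  move=> w Ww; have gS' : geodesic_segment x y (act w @` S).
    by have := geodesic_segment_isometry (act_dist w) gS; rewrite xW // yW.
  apply/esym/(cat0_geodesic_unique _ gS gS' Sp); [by case: hc|by exists p|].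
  by rewrite -{2}(xW w Ww) act_dist.
split; last by apply: (Y2 x y).
move=> w Ww; have [S gS] := geoX x y.
have gS' : geodesic_segment x y (act w @` S).
  by have := geodesic_segment_isometry (act_dist w) gS; rewrite xW // yW.
have [q Sq qp] := Sp _ gS'.
have pq : p = q.
  apply: (geodesic_segment_inj gS (Sp _ gS) Sq).
  by rewrite -qp -{1}(xW w Ww) act_dist.
by rewrite {1}pq.
Qed.

Section Fixators.
Hypotheses (hXp : proper_space X) (hprop : proper_action act) (hdisc : locally_discrete act).
Variables (Y : set X) (y0 : X).
Hypothesis Yy0 : Y y0.

Definition ball_fixator (j : nat) := fixator act [set y | Y y /\ (mdist y0 y <= j%:R)%R].

(** Openness: finitely many balls with open fixators cover a closed ball of [X]. Compactness: the
    fixator fixes [y0], and the action is proper. *)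
Lemma ball_fixator_compact_open j : compact_open_subgroup (ball_fixator j).
Proof.
have sO : subgroup (ball_fixator j) by exact: subgroup_fixator.
have oO : open (ball_fixator j).
  have [U [oO sO' HO]] : exists U, [/\ open U, subgroup U & U `<=` fixator act [set y | (mdist y0 y <= j%:R)%R]].
    apply: (compact_local_to_global (Q := fun A => exists U, [/\ open U, subgroup U & U `<=` fixator act A])).
    - exact: hXp.
    - exists setT; split=> //; [exact: openT|by move=> h _ y].
    - by move=> A B AB [U [oO sO' HO]]; exists U; split=> // h /HO hB y /AB; apply: hB.
    - move=> A B [U [oO sO' HO]] [U' [oO' sO'' HO']]; exists (U `&` U'); split.
      + exact: openI.
      + exact: subgroupI.
      + by move=> h [/HO hA /HO' hB] y [/hA|/hB].
    - move=> x _; have [r r0 openr] := hdisc x; exists (ball x r); first exact: nbhsx_ballx.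
      by exists (fixator act (ball x r)); split=> //; exact: subgroup_fixator.
  apply: (right_invariant_open oO sO') => h o hj Oo; apply: (subgroupM sO hj).
  by move=> y [_ yj]; exact: HO Oo _ yj.
have cS := @hprop y0 _ ltr01.
split=> //; apply: (subclosed_compact _ cS).
  exact: open_subgroup_closed.
move=> h hj; apply: subset_closure => /=.
by rewrite hj ?mdistxx ?ler01 //; split=> //; rewrite mdistxx.
Qed.

Lemma ball_fixator_dec j : ball_fixator j.+1 `<=` ball_fixator j.
Proof.
move=> h hj y [Yy yj]; apply: hj; split=> //; apply: le_trans yj _.
by rewrite ler_nat.
Qed.

Lemma ball_fixatorP h : fixator act Y h <-> forall j, ball_fixator j h.
Proof.
split=> [hY j y [Yy _]|hj y Yy]; first exact: hY.
apply: (hj (Num.Def.archi_bound (mdist y0 y))); split=> //.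
by rewrite ltW // archi_boundP // mdist_ge0.
Qed.

End Fixators.
End Action.

Local Open Scope group_scope.

(** * The contraction group relative to the fixator of [Y], and the scale of [g^-1] *)

Section ContractionFixators.
Variables (R : realType) (X : metricType R) (G : topologicalGroupType).
Variable act : G -> X -> X.
Hypotheses (hXp : proper_space X) (hact : isometric_action act)
  (hprop : proper_action act) (hdisc : locally_discrete act).
Variables (g : G) (Y : set X) (y0 : X).
Hypotheses (Yy0 : Y y0) (hYg : invariant_under_powers act g Y).
Implicit Types (V : set G) (h w : G) (y z : X) (n N : nat).

Let a := conj_zaction g.
Let K := fixator act Y.
Let L := con g K.
Let O := ball_fixator act Y y0.
(** The stabilizer of [y], written as a [ball_fixator] to inherit that it is compact and open. *)
Let stab y := ball_fixator act [set y] y 0.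

Lemma act_conj (m : int) h y :
  act (a m h) y = y <-> act h (act (expgz g (- m)%R) y) = act (expgz g (- m)%R) y.
Proof.
have gm : expgz g (- m)%R = (expgz g m)^-1.
  by apply: (mulgI (expgz g m)); rewrite -expgzD subrr mulgV.
rewrite /a /= /conj_zaction_fun gm !(actM hact); split=> [e|->]; last by rewrite (actKV hact).
by rewrite -{2}e (actK hact).
Qed.

Lemma invariant_zact (m : int) y : Y y -> Y (act (expgz g m) y).
Proof. by move=> Yy; apply: (hYg (m := m)); exists y. Qed.

Lemma stabP y h : stab y h <-> act h y = y.
Proof.
split=> [|hy z [-> _] //]; apply; split=> //.
by rewrite mdistxx.
Qed.

Lemma stab_compact_open y : compact_open_subgroup (stab y).
Proof. exact: ball_fixator_compact_open. Qed.

Lemma fixator_zact (m : int) h : K h -> K (a m h).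
Proof. by move=> Kh y Yy; apply/act_conj/Kh/invariant_zact. Qed.

Lemma con_fixatorP h : L h <-> forall j, exists N, forall n, (N <= n)%N -> O j (a n h).
Proof.
apply: conP; [exact: ball_fixator_compact_open|exact: ball_fixator_dec|].
exact: ball_fixatorP.
Qed.

Lemma fixator_con : K `<=` L.
Proof.
move=> k Kk; apply/con_fixatorP => j; exists 0%N => n _.
exact: (ball_fixatorP act Y y0 _).1 (fixator_zact _ Kk) j.
Qed.

Lemma subgroup_con : subgroup L.
Proof.
have sO j : subgroup (O j) by exact: subgroup_fixator.
split.
- by apply: fixator_con; exact: (subgroup1 (subgroup_fixator hact Y)).
- move=> h w /con_fixatorP Lh /con_fixatorP Lw; apply/con_fixatorP => j.
  have [M HM] := Lh j; have [N HN] := Lw j.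
  exists (maxn M N) => n; rewrite geq_max => /andP[Mn Nn].
  by rewrite zactM; exact: (subgroupM (sO j) (HM n Mn) (HN n Nn)).
- move=> h /con_fixatorP Lh; apply/con_fixatorP => j.
  have [N HN] := Lh j; exists N => n Nn.
  by rewrite zactV; exact: (subgroupV (sO j) (HN n Nn)).
Qed.

Lemma con_zact (m : int) h : L h -> L (a m h).
Proof.
move=> /con_fixatorP Lh; apply/con_fixatorP => j.
have [N HN] := Lh j; exists (N + `|m|)%N => n Nn.
rewrite -zactD (_ : (n%:Z + m = `|(n%:Z + m)%R|%N%:Z)%R); last by lia.
by apply: HN; lia.
Qed.

Lemma con_eventually_fix h y : L h -> Y y ->
  exists N, forall n, (N <= n)%N -> act (a n h) y = y.
Proof.
move=> /con_fixatorP Lh Yy.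
have [N HN] := Lh (Num.Def.archi_bound (mdist y0 y)).
exists N => n Nn; apply: (HN n Nn); split=> //.
by rewrite ltW // archi_boundP // mdist_ge0.
Qed.

(** As [L] is closed, [V ∩ L] is compact, and [compact_uniform] applies to the subgroups
    [alpha ^ -n (stab y)]. *)
Lemma con_uniformly_fix V y : closed L -> compact_open_subgroup V -> Y y ->
  exists N, forall n w, (N <= n)%N -> V w -> L w -> act (a n w) y = y.
Proof.
move=> clL [sV cV oV] Yy; have [sS _ oS] := stab_compact_open y.
have clV := open_subgroup_closed oV sV.
have [||||||N HN] := @compact_uniform G (V `&` L) (fun n => zimage a (- n%:Z)%R (stab y)).
- exact: subgroupI subgroup_con.
- exact: compact_closedI.
- exact: closedI.
- by move=> m; exact: subgroup_zimage.
- by move=> m; exact: open_zimage.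
- move=> w [_ Lw]; have [N HN] := con_eventually_fix Lw Yy; exists N => n /HN fixy.
  by rewrite /zimage /= opprK; apply/stabP.
exists N => n w /HN Wn Vw Lw; apply/stabP.
by have := Wn w (conj Vw Lw); rewrite /zimage /= opprK.
Qed.

(** The [O j] decrease to [K], so one of them lies in the open set [K V], and [alpha ^ n (h)] enters
    it. Questions on [L] are thereby reduced to [V ∩ L]. *)
Lemma con_factor V h : compact_open_subgroup V -> L h ->
  exists n k v, [/\ K k, V v, L v & a n h = k * v].
Proof.
move=> [sV cV oV] Lh.
have oKV : open (setmulg K V).
  apply: (right_invariant_open oV sV) => _ v' [k [v [Kk Vv ->]]] Vv'.
  by exists k, (v * v'); split; rewrite ?mulgA //; exact: subgroupM.
have cosO j : compact_open_subgroup (O j) by exact: ball_fixator_compact_open.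
have [j OKV] : exists j, O j `<=` setmulg K V.
  apply: contrapT => /forallNP nO; have [_ cO0 _] := cosO 0%N.
  have [|j|j z [Oz nz]|j|z Fz] := @compact_nested _ (O 0%N) (fun j => O j `&` ~` setmulg K V) cO0.
  - by move=> i z [+ _]; elim: i => [//|i IH /ball_fixator_dec].
  - have [sO _ oO] := cosO j.
    by apply: closedI; [exact: open_subgroup_closed|rewrite closedC].
  - by split=> //; apply: ball_fixator_dec.
  - apply: contrapT => nF; have := nO j; apply=> z Oz; apply: contrapT => nz.
    by apply: nF; exists z.
  - have [_] := Fz 0%N; apply; exists z, 1; split; rewrite ?mulg1 //; last exact: subgroup1.
    by apply/(ball_fixatorP _ _ y0) => j; have [] := Fz j.
have [N HN] := (con_fixatorP h).1 Lh j.
have [k [v [Kk Vv e]]] := OKV _ (HN N (leqnn N)).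
exists N, k, v; split=> //.
rewrite (_ : v = k^-1 * a N h); last by rewrite e mulKg.
have sL := subgroup_con.
exact: (subgroupM sL (subgroupV sL (fixator_con Kk)) (con_zact _ Lh)).
Qed.

Lemma scale_inv_minimal V : compact_open_subgroup V ->
  exists U, scale_minimal (zopp a) U (scale g^-1).
Proof.
move=> cosV; have [[U minU] _] := scale_attained g^-1 cosV.
by exists U; apply: scale_minimalP minU => A; exact: conjset_zimageV.
Qed.

Lemma con_trivial V : compact_open_subgroup V -> closed L ->
  scale g^-1 = 1%N -> L = K.
Proof.
move=> cosV clL s1; have [U [cosU]] := scale_inv_minimal cosV.
rewrite s1 => -[f cf] _; have [sU _ _] := cosU.
(* Scale 1 means that one coset of [U] covers [alpha ^ -1 (U)], which therefore lies in [U]. *)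
have U1 x : U (a 1%R x) -> U x.
  rewrite -[1%R]opprK => Ux; have [i Ui] := cf x Ux.
  have [j Uj] := cf 1 (subgroup1 (subgroup_zimage (zopp a) 1 sU)).
  have := subgroupM sU (subgroupV sU Uj) Ui; rewrite (ord1 i) (ord1 j).
  by gsimp.
have Un n x : U x -> U (a (- n%:Z)%R x).
  elim: n => [|n IH] Ux; first by rewrite oppr0 zact0.
  apply: U1; rewrite -zactD (_ : (1 - n.+1%:Z = - n%:Z)%R); last by lia.
  exact: IH.
(* [w] is the image under [alpha ^ N] of an element of [U ∩ L], so uniform contraction makes it fix
   [y]. *)
have UL w : U w -> L w -> K w.
  move=> Uw Lw y Yy; have [N HN] := con_uniformly_fix clL cosU Yy.
  rewrite -[w](@zactKV _ a N%:Z); apply: HN => //; first exact: Un.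
  exact: con_zact.
apply/seteqP; split; last exact: fixator_con.
move=> h Lh; have [n [k [v [Kk Uv Lv e]]]] := con_factor cosU Lh.
rewrite -[h](@zactK _ a n%:Z) e; apply: fixator_zact.
exact: (subgroupM (subgroup_fixator hact Y) Kk (UL v Uv Lv)).
Qed.

(* Conversely, a compact contraction group forces the scale of [g^-1] to be 1:
   if [U] is minimizing for [g^-1], then [U_-] lies in [U_0 L] by shadowing, so
   its elements have bounded orbits and [U_-] is invariant. *)
Lemma scale_inv_eq1 V y : compact_open_subgroup V ->
  (forall h, L h -> act h y = y) -> scale g^-1 = 1%N.
Proof.
move=> cosV Ly; have [U minU] := scale_inv_minimal cosV.
have [cosU cU sepU] := minU; have [sU cptU oU] := cosU.
have clU := open_subgroup_closed oU sU.
have [sS cS oS] := stab_compact_open y.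
(* Starting with [T 0 = U] makes the correction [c] below an element of [U_0]. *)
pose T j := if j is i.+1 then U `&` O i else U.
have cosO j : compact_open_subgroup (O j) by exact: ball_fixator_compact_open.
have cosT j : compact_open_subgroup (T j).
  case: j => [//|j]; have [sO _ oO] := cosO j; split.
  - exact: subgroupI.
  - by apply: compact_closedI => //; exact: open_subgroup_closed.
  - exact: openI.
have decT j : T j.+1 `<=` T j.
  by case: j => [|j] x [Ux Ox]; [|split=> //; exact: ball_fixator_dec].
have [k ck] : exists k, covered (setmulg U (stab y)) U k.
  by apply: compact_covered => //; exact: compact_setmulg.
have step x : U x -> U (a (- 1)%R x).
  move=> Ux; have [p Up Uq] := tidy_above_factor sU cptU clU (minimal_tidy_above minU) Ux.
  rewrite -(mulVKg p x) zactM; apply: subgroupM => //; last exact: (Uq 1%N).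
  have Upn n : U (a n p) by have := Up n; rewrite /= opprK.
  have [c Uc cT] := @contraction_approximation _ a T p 0 cosT decT (fun n _ => Upn n).
  have Lcp : L (c * p).
    apply/con_fixatorP => j; have [N HN] := cT j.+1.
    by exists N => n /HN[].
  apply: (@minimal_bounded _ _ _ _ minU p 0 k); first by have := Upn 0%N; rewrite zact0.
  apply: covered_sub ck => // _ [n _ <-].
  (* The first factor is in [U] because [c] is in [U_0]; the second fixes [y] because [L] is
     [alpha]-invariant. So the orbit of [p] under [alpha ^ -1] stays in the compact set
     [U (stab y)]. *)
  exists (zopp a n c^-1), (zopp a n (c * p)); split.
  - by rewrite zactV; apply: subgroupV => //; exact: Uc.
  - by apply/stabP/Ly/con_zact.
  - by rewrite -zactM mulKg.
have c1 : covered (zimage (zopp a) 1 U) U 1.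
  exists (fun=> 1) => x; rewrite /zimage /= => Ux; exists ord0; gsimp.
  by have := step _ Ux; rewrite -zactD addNr zact0.
have le1 := separated_leq_covered sU c1 (sepU U cosU).
have [f cf] := cU; have [i _] := cf 1 (subgroup1 (subgroup_zimage (zopp a) 1 sU)).
by apply/eqP; rewrite eqn_leq le1 (leq_ltn_trans _ (ltn_ord i)).
Qed.

(** The forward orbit of [w] ends in the compact stabilizer of [y0], hence in finitely many cosets
    of [V]; [minimal_bounded] gives one step, which is iterated. *)
Lemma minimizing_con_stable V w n : minimizing g V -> V w -> L w -> V (a n w).
Proof.
move=> minV; have [cosV _] := minV; have [sV _ oV] := cosV.
have [_ cS _] := stab_compact_open y0.
have [k ck] := compact_covered cS oV sV.
elim: n w => [|n IH] w Vw Lw; first by rewrite zact0.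
rewrite (_ : (n.+1%:Z = n%:Z + 1)%R); last by lia.
rewrite zactD; apply: IH; last exact: con_zact.
have [N HN] := con_eventually_fix Lw Yy0.
apply: (minimal_bounded (scale_minimalP (conjset_zimage g) minV) Vw (N := N) (k := k)).
by apply: covered_sub ck => // _ [m /= Nm <-]; apply/stabP/HN.
Qed.

Lemma act_expgzK (m : int) x : act (expgz g m) (act (expgz g (- m)%R) x) = x.
Proof. by rewrite -(actM hact) -expgzD subrr (act1 hact). Qed.

Section FixedPoints.
Variable V : set G.
Hypotheses (minV : minimizing g V) (clL : closed L).
Let Z := fixed_points act (V `&` L) `&` Y.

Let cosV : compact_open_subgroup V. Proof. by case: minV. Qed.

Lemma fixed_points_increasing : Z `<=` act g @` Z.
Proof.
move=> z [Wz Yz]; exists (act g^-1 z); last exact: (actKV hact).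
have gz : act g^-1 z = act (expgz g (- 1)%R) z by [].
split; last by rewrite gz; exact: invariant_zact.
move=> w [Vw Lw]; rewrite gz; apply/act_conj/Wz.
by split; [exact: (minimizing_con_stable 1%N minV Vw Lw)|exact: con_zact].
Qed.

Lemma fixed_points_bigcup : \bigcup_(n in [set n : int | (0 <= n)%R]) (act (expgz g n) @` Z) = Y.
Proof.
apply/seteqP; split=> y.
  by move=> [n _ [z [_ Yz] <-]]; exact: invariant_zact.
move=> Yy; have [N HN] := con_uniformly_fix clL cosV Yy.
exists N%:Z => //; exists (act (expgz g (- N%:Z)%R) y); last exact: act_expgzK.
split; last exact: invariant_zact.
by move=> w [Vw Lw]; apply/act_conj/HN.
Qed.

(** A point [y] of the intersection has [g ^ n y] in [Z] for all [n >= 0]. For [h] in [L], write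
    [alpha ^ n (h) = k v] by [con_factor]; as [v] fixes [g ^ n y], [h] fixes [y], and
    [scale_inv_eq1] applies. *)
Lemma fixed_points_bigcap : scale g^-1 <> 1%N ->
  \bigcap_(n in [set n : int | (n <= 0)%R]) (act (expgz g n) @` Z) = set0.
Proof.
move=> s1; apply/seteqP; split=> // y Zy; apply: s1.
have Zn (n : nat) : Z (act (expgz g n) y).
  have [|z Zz <-] := Zy (- n%:Z)%R; first by rewrite /=; lia.
  by rewrite act_expgzK.
have Yy : Y y by have := (Zn 0%N).2; rewrite /= expg0 (act1 hact).
apply: (@scale_inv_eq1 V y cosV) => h Lh.
have [n [k [v [Kk Vv Lv e]]]] := con_factor cosV Lh.
rewrite -[h](@zactK _ a n%:Z) e zactM (actM hact).
rewrite (_ : act (a (- n%:Z)%R v) y = y); first exact: (fixator_zact _ Kk).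
by apply/act_conj; rewrite opprK; apply: (Zn n).1.
Qed.

End FixedPoints.
End ContractionFixators.

End Development.

Theorem corollary1p16 (R : realType) (X : metricType R)
    (hX : npc_space X) (hXp : proper_space X)
    (G : topologicalGroupType) (hG : tdlc G)
    (act : G -> X -> X) (hact : isometric_action act)
    (hprop : proper_action act) (hdisc : locally_discrete act)
    (g : G) (hg : hyperbolic_element act g)
    (Y : set X) (hY0 : Y !=set0) (hYcl : closed Y) (hYcv : convex_subset Y)
    (hYg : invariant_under_powers act g Y)
    (V : set G) (hV : minimizing g V) :
  let K := fixator act Y in
  let W := V `&` con g K in
  let Z := fixed_points act W `&` Y in
  closed (con g K) ->
  (scale (g^-1)%g = 1%N -> con g K = K /\ Z = Y) /\
  (scale (g^-1)%g <> 1%N ->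
     [/\ closed Z,
         convex_subset Z,
         Z `<=` act g @` Z,
         \bigcup_(n in [set n : int | 0 <= n]) (act (expgz g n) @` Z) = Y
       & \bigcap_(n in [set n : int | n <= 0]) (act (expgz g n) @` Z) = set0]).
Proof.
move=> K W Z clL; have [y0 Yy0] := hY0; have [cosV _] := hV.
split=> [s1|s1].
  have LK := con_trivial hXp hact hprop hdisc Yy0 hYg cosV clL s1.
  split=> //; apply/seteqP; split=> [y []//|y Yy]; split=> // w [_].
  by rewrite LK; apply.
split.
- by apply: closedI => //; exact: closed_fixed_points.
- exact: convex_fixed_points.
- exact: (fixed_points_increasing hXp hact hprop hdisc Yy0 hYg hV).
- exact: (fixed_points_bigcup hXp hact hprop hdisc Yy0 hYg hV clL).
- exact: (fixed_points_bigcap hXp hact hprop hdisc Yy0 hYg hV s1).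
Qed.
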